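(* Let $n\ge7$. There exists a smooth positive function $u\in L^\infty(\mathbb{H}_1^{n-2}\times\mathbb{S}^2)\cap L^{p_n}(\mathbb{H}_1^{n-2}\times\mathbb{S}^2)$ which satisfies $$L^{G_1}u=0$$ and is not in $L^2(\mathbb{H}_1^{n-2}\times\mathbb{S}^2)$.
   Context: Set $a_n=\frac{4(n-1)}{n-2}$ and $p_n=\frac{2n}{n-2}$. $\mathbb{H}_1^{n-2}$ is the hyperbolic space of dimension $n-2$ with constant sectional curvature $-1$, $\mathbb{S}^2$ is the unit $2$-sphere with its standard round metric, and $G_1$ is the product metric on $\mathbb{H}_1^{n-2}\times\mathbb{S}^2$. For a Riemannian metric $g$ on an $n$-dimensional manifold, $L^g=a_n\Delta^g+s^g$ is the conformal Laplacian, where $s^g$ is the scalar curvature and $\Delta^g=-\mathrm{div}\,\mathrm{grad}$ is the non-negative Laplace operator. $L^p$ spaces are taken with respect to the Riemannian volume measure of $G_1$. *)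

(* Defs.v *)
From HB Require Import structures.
From mathcomp Require Import all_boot all_order all_algebra.
From mathcomp Require Import all_classical all_reals all_analysis.
From mathcomp Require Import measurable_realfun ring lra.
Set Implicit Arguments.
Unset Strict Implicit.
Unset Printing Implicit Defensive.
Import Order.TTheory GRing.Theory Num.Theory.
Import numFieldNormedType.Exports.
Local Open Scope classical_set_scope.
Local Open Scope ring_scope.

Definition rV_display : measure_display.
Proof. exact: default_measure_display. Qed.

Section measurable_rV.
Context {R : realType}.
Variable n : nat.

Let coors : 'I_n -> 'rV[R]_n -> R := fun i x => x 0 i.

Let rV_set0 : g_sigma_preimage coors set0.
Proof. exact: sigma_algebra0. Qed.

Let rV_setC A : g_sigma_preimage coors A -> g_sigma_preimage coors (~` A).
Proof. exact: sigma_algebraC. Qed.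

Let rV_bigcup (F : (set 'rV[R]_n)^nat) :
  (forall i, g_sigma_preimage coors (F i)) ->
  g_sigma_preimage coors (\bigcup_i (F i)).
Proof. exact: sigma_algebra_bigcup. Qed.

(* The sigma-algebra generated by the coordinates, i.e. the Borel one. *)
HB.instance Definition _ := @isMeasurable.Build rV_display
  'rV[R]_n (g_sigma_preimage coors) rV_set0 rV_setC rV_bigcup.

Lemma measurable_coord_rV (i : 'I_n) :
  measurable_fun setT (fun x : 'rV[R]_n => x 0 i : R).
Proof.
move=> _ Y mY; rewrite setTI; apply: sub_sigma_algebra => /=.
rewrite -bigcup_seq/=; exists i => /=; first by rewrite mem_index_enum.
by exists Y => //; rewrite setTI.
Qed.

Lemma measurable_fun_rV d (T : measurableType d) (f : T -> 'rV[R]_n) :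
  (forall i, measurable_fun setT (fun x => f x 0 i : R)) ->
  measurable_fun setT f.
Proof.
move=> mf.
suff H : g_sigma_preimage (fun i => coors i \o f) `<=` measurable.
  move=> _ A mA; apply: H; rewrite g_sigma_preimage_comp.
  by exists A => //; rewrite setTI.
apply: smallest_sub; first exact: sigma_algebra_measurable.
rewrite -bigcup_seq; apply: bigcup_sub => i _.
by move=> A [B mB <-]; exact: mf.
Qed.

End measurable_rV.

Section lebesgue_rV.
Context {R : realType}.
Local Open Scope ereal_scope.

Definition cons_rV n (p : measurableTypeR R * 'rV[R]_n) : 'rV[R]_n.+1 :=
  row_mx (p.1%:M : 'rV[R]_1) p.2.

Definition uncons_rV n (x : 'rV[R]_n.+1) : measurableTypeR R * 'rV[R]_n :=
  (x 0 0, rsubmx (x : 'rV[R]_(1 + n)))%R.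

Lemma cons_rVK n : cancel (@cons_rV n) (@uncons_rV n).
Proof.
move=> [a x]; rewrite /uncons_rV /cons_rV row_mxKr /=; congr pair.
by rewrite mxE; case: splitP => // j _; rewrite mxE ord1 eqxx mulr1n.
Qed.

Lemma uncons_rVK n : cancel (@uncons_rV n) (@cons_rV n).
Proof.
move=> x; apply/rowP => i; rewrite !mxE.
case: splitP => j ij; rewrite !mxE; last by congr (x _ _); exact: val_inj.
by rewrite !ord1 eqxx mulr1n; congr (x _ _); apply: val_inj; rewrite /= ij ord1.
Qed.

Lemma measurable_cons_rV n : measurable_fun setT (@cons_rV n).
Proof.
apply: measurable_fun_rV => i; rewrite /cons_rV.
case: (split_ordP (i : 'I_(1 + n))) => j ->.
- rewrite (_ : (fun _ => _) = fst)//; apply/funext => -[a x].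
  by apply: etrans (row_mxEl _ _ _ _) _; rewrite mxE !ord1 eqxx mulr1n.
- rewrite (_ : (fun _ => _) = (fun x : 'rV[R]_n => x 0%R j : R) \o snd).
    by apply: measurableT_comp => //; exact: measurable_coord_rV.
  by apply/funext => -[a x]; apply: etrans (row_mxEr _ _ _ _) _.
Qed.

Lemma measurable_uncons_rV n : measurable_fun setT (@uncons_rV n).
Proof.
apply/measurable_fun_pairP; split => /=.
  exact: (measurable_coord_rV (ord0 : 'I_n.+1)).
apply: measurable_fun_rV => i /=.
rewrite (_ : (fun _ => _) = (fun x : 'rV[R]_n.+1 => x 0%R (rshift 1 i) : R)).
  exact: measurable_coord_rV.
by apply/funext => x /=; rewrite mxE.
Qed.

Section step.
Variables (n : nat) (mu : {sigma_finite_measure set 'rV[R]_n -> \bar R}).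

Definition lebesgue_cons : set 'rV[R]_n.+1 -> \bar R :=
  pushforward (@lebesgue_measure R \x mu) (@cons_rV n).


Let nu : {measure set 'rV[R]_n.+1 -> \bar R} :=
  measure_function_pushforward__canonical__measure_function_Measure
    (@lebesgue_measure R \x mu) (@measurable_cons_rV n).

Let lebesgue_cons0 : lebesgue_cons set0 = 0.
Proof. exact: (measure0 nu). Qed.

Let lebesgue_cons_ge0 A : 0 <= lebesgue_cons A.
Proof. exact: (measure_ge0 nu). Qed.

Let lebesgue_cons_sigma_additive : semi_sigma_additive lebesgue_cons.
Proof. exact: (@measure_semi_sigma_additive _ _ _ nu). Qed.

HB.instance Definition _ := isMeasure.Build _ _ _ lebesgue_cons
  lebesgue_cons0 lebesgue_cons_ge0 lebesgue_cons_sigma_additive.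

Let lebesgue_cons_sigma_finite : sigma_finite setT lebesgue_cons.
Proof.
have /sigma_finiteP[F [FT ndF Ffin]] := sigma_finiteT
  [the {sigma_finite_measure set _ -> \bar R} of @lebesgue_measure R].
have /sigma_finiteP[G [GT ndG Gfin]] := sigma_finiteT mu.
exists (fun k => @uncons_rV n @^-1` (F k `*` G k)).
  rewrite -preimage_bigcup -(preimage_setT (@uncons_rV n)); congr preimage.
  rewrite -setXTT FT GT predeqE => -[x y]; split.
    move=> [/= [i _ Fix] [k _ Gky]]; exists (maxn i k) => //; split.
    - by move: x Fix; exact/subsetPset/ndF/leq_maxl.
    - by move: y Gky; exact/subsetPset/ndG/leq_maxr.
  by move=> [i _ []/= ? ?]; split; exists i.
move=> k; have [mF Foo] := Ffin k; have [mG Goo] := Gfin k; split.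
  rewrite -[X in measurable X]setTI; apply: measurable_uncons_rV => //.
  exact: measurableX.
rewrite /lebesgue_cons /pushforward -comp_preimage.
rewrite (_ : _ \o _ = id) ?preimage_id.
  by rewrite product_measure1E// lte_mul_pinfty// ge0_fin_numE.
by apply/funext => p /=; rewrite cons_rVK.
Qed.

HB.instance Definition _ := Measure_isSigmaFinite.Build _ _ _ lebesgue_cons
  lebesgue_cons_sigma_finite.

End step.

Fixpoint lebesgue_rV n : {sigma_finite_measure set 'rV[R]_n -> \bar R} :=
  match n with
  | 0 => dirac (0%R : 'rV[R]_0)
  | m.+1 => lebesgue_cons (lebesgue_rV m)
  end.

End lebesgue_rV.

Section chart.
Context {R : realType} {n : nat}.
Implicit Types (g : 'rV[R]_n -> 'M[R]_n) (f : 'rV[R]_n -> R).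

Definition partial (i : 'I_n) f : 'rV[R]_n -> R :=
  fun x => 'D_(delta_mx 0 i) f x.

(* C^oo on the open set U: every iterated partial derivative of f is        *)
(* differentiable, hence continuous, at every point of U.                   *)
Definition smooth_on (U : set 'rV[R]_n) f :=
  forall (s : seq 'I_n) x, U x -> differentiable (foldr partial f s) x.

Definition metric_inv g (i j : 'I_n) : 'rV[R]_n -> R :=
  fun x => invmx (g x) i j.

Definition volume_density g : 'rV[R]_n -> R := fun x => Num.sqrt (\det (g x)).

Definition gradient g f (i : 'I_n) : 'rV[R]_n -> R :=
  fun x => \sum_j metric_inv g i j x * partial j f x.

Definition divergence g (X : 'I_n -> 'rV[R]_n -> R) : 'rV[R]_n -> R :=
  fun x => (volume_density g x)^-1 *
    \sum_i partial i (fun z => volume_density g z * X i z) x.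

Definition laplacian g f : 'rV[R]_n -> R :=
  fun x => - divergence g (gradient g f) x.

Definition christoffel g (k i j : 'I_n) : 'rV[R]_n -> R :=
  fun x => 2^-1 * \sum_l metric_inv g k l x *
    (partial i (fun z => g z j l) x + partial j (fun z => g z i l) x
     - partial l (fun z => g z i j) x).

(* R_ij = d_k G^k_ij - d_j G^k_ik + G^k_kl G^l_ij - G^k_jl G^l_ik, positive *)
(* on round spheres.                                                        *)
Definition ricci g (i j : 'I_n) : 'rV[R]_n -> R :=
  fun x =>
    \sum_k (partial k (christoffel g k i j) x
             - partial j (christoffel g k i k) x)
    + \sum_k \sum_l (christoffel g k k l x * christoffel g l i j x
                     - christoffel g k j l x * christoffel g l i k x).

Definition scalar_curvature g : 'rV[R]_n -> R :=
  fun x => \sum_i \sum_j metric_inv g i j x * ricci g i j x.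

(* The constant is a_n for the dimension n of the chart.                    *)
Definition conformal_laplacian g f : 'rV[R]_n -> R :=
  fun x => 4 * (n%:R - 1) / (n%:R - 2) * laplacian g f x
           + scalar_curvature g x * f x.

End chart.

(* Pull-back by psi of the Euclidean metric of R^m. *)
Definition induced_metric {R : realType} {n m} (psi : 'rV[R]_n -> 'rV[R]_m) :
    'rV[R]_n -> 'M[R]_n :=
  fun x => \matrix_(i, j) \sum_k partial i (fun z => psi z 0 k) x *
                                 partial j (fun z => psi z 0 k) x.

Definition product_metric {R : realType} {n m} (g : 'rV[R]_n -> 'M[R]_n)
    (h : 'rV[R]_m -> 'M[R]_m) : 'rV[R]_(n + m) -> 'M[R]_(n + m) :=
  fun x => block_mx (g (lsubmx x)) 0 0 (h (rsubmx x)).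

Section models.
Context {R : realType}.

Definition sqnorm n (x : 'rV[R]_n) : R := \sum_i x 0 i ^+ 2.

(* Upper half-space model of the hyperbolic space of dimension m >= 1; the  *)
(* dimension is written m.-1.+1 so that there is a last coordinate.         *)
Definition half_space {m} : set 'rV[R]_m.-1.+1 := [set x | 0 < x 0 ord_max].

Definition hyperbolic_metric {m} (x : 'rV[R]_m.-1.+1) : 'M[R]_m.-1.+1 :=
  (x 0 ord_max ^- 2)%:M.

Definition sphere {n} : set 'rV[R]_(n + 1) := [set p | sqnorm p = 1].

(* Inverse of the stereographic projection from the north pole              *)
(* (b = false) or the south pole (b = true); its range is the sphere        *)
(* without that pole.                                                       *)
Definition stereo n (b : bool) (y : 'rV[R]_n) : 'rV[R]_(n + 1) :=
  (1 + sqnorm y)^-1 *: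
    row_mx (2 *: y) ((-1) ^+ b * (sqnorm y - 1))%:M.

Lemma derive_coord n (x v : 'rV[R]_n) i :
  is_derive x v (fun z : 'rV[R]_n => z 0 i : R) (v 0 i).
Proof.
have df : differentiable (fun z : 'rV[R]_n => z 0 i : R) x.
  exact: differentiable_coord.
apply: DeriveDef; first exact: diff_derivable.
rewrite deriveE//.
pose L : {linear 'rV[R]_n -> R} := HB.pack (fun z : 'rV[R]_n => z 0 i : R)
  (GRing.isLinear.Build _ _ _ _ (fun z : 'rV[R]_n => z 0 i : R)
    (fun a u w => etrans (mxE _ _ _ _) (congr1 (fun t => t + w 0 i) (mxE _ _ _ _)))).
by have /diff_lin -> // : continuous L by move=> z; exact: coord_continuous.
Qed.

Lemma derive_sqnorm n (x v : 'rV[R]_n) :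
  is_derive x v (@sqnorm n) (2 * \sum_i x 0 i * v 0 i).
Proof.
rewrite (_ : @sqnorm n = \sum_(i < n) (fun z : 'rV[R]_n => z 0 i : R) ^+ 2).
  apply: is_derive_eq; first by apply: is_derive_sum => i;
    apply: is_deriveX; exact: derive_coord.
  rewrite mulr_sumr; apply: eq_bigr => i _.
  by rewrite /GRing.scale/= expr1 mulrA.
by apply/funext => z; rewrite fct_sumE.
Qed.

Lemma sqnorm_ge0 n (x : 'rV[R]_n) : 0 <= sqnorm x.
Proof. by apply: sumr_ge0 => i _; exact: sqr_ge0. Qed.

Lemma sqnorm1_neq0 n (x : 'rV[R]_n) : 1 + sqnorm x != 0.
Proof. by rewrite gt_eqF// ltr_pwDl// sqnorm_ge0. Qed.

Lemma derive_sqnorm1V n (x v : 'rV[R]_n) :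
  is_derive x v (fun z => (1 + sqnorm z)^-1)
    (- (1 + sqnorm x) ^- 2 * (2 * \sum_i x 0 i * v 0 i)).
Proof.
have d : is_derive x v (fun z => 1 + sqnorm z) (2 * \sum_i x 0 i * v 0 i).
  have := is_deriveD (is_derive_cst (1 : R) x v) (derive_sqnorm x v).
  by rewrite add0r.
pose f (z : 'rV[R]_n) : R := 1 + sqnorm z.
have q0 : f x != 0 by exact: sqnorm1_neq0.
have df : derivable f x v by case: d.
apply: DeriveDef; first exact: derivableV q0 df.
by rewrite (deriveV q0 df) (@derive_val _ _ _ _ _ _ _ d).
Qed.

Lemma partial_stereol n b (y : 'rV[R]_n) (i k : 'I_n) :
  partial i (fun z => stereo b z 0 (lshift 1 k)) y =
  2 * (k == i)%:R / (1 + sqnorm y) - 4 * y 0 i * y 0 k / (1 + sqnorm y) ^+ 2.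
Proof.
rewrite /partial (_ : (fun z => _) = (fun z : 'rV[R]_n => (1 + sqnorm z)^-1) *
    ((2 : R) \*: (fun z : 'rV[R]_n => z 0 k : R))); last first.
  by apply/funext => z; rewrite mxE row_mxEl !mxE.
have := is_deriveM (derive_sqnorm1V y (delta_mx 0 i))
  (is_deriveZ (2 : R) (derive_coord y (delta_mx 0 i) k)).
move=> /(@derive_val _ _ _ _ _ _ _) ->.
rewrite (bigD1 i)//= big1 => [|j /negbTE ji]; last by rewrite !mxE ji mulr0.
rewrite !mxE !eqxx/= mulr1 addr0 /GRing.scale/=.
by field; rewrite sqnorm1_neq0.
Qed.

Lemma partial_stereor n b (y : 'rV[R]_n) (i : 'I_n) (k : 'I_1) :
  partial i (fun z => stereo b z 0 (rshift n k)) y =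
  (-1) ^+ b * 4 * y 0 i / (1 + sqnorm y) ^+ 2.
Proof.
rewrite /partial (_ : (fun z => _) = (fun z : 'rV[R]_n => (1 + sqnorm z)^-1) *
    (((-1) ^+ b : R) \*: (@sqnorm n - cst 1))); last first.
  by apply/funext => z; rewrite mxE row_mxEr !mxE ord1 eqxx mulr1n.
have := is_deriveM (derive_sqnorm1V y (delta_mx 0 i))
  (is_deriveZ ((-1) ^+ b : R) (is_deriveB (derive_sqnorm y (delta_mx 0 i))
    (is_derive_cst (1 : R) y (delta_mx 0 i)))).
move=> /(@derive_val _ _ _ _ _ _ _) ->.
rewrite (bigD1 i)//= big1 => [|j /negbTE ji]; last by rewrite !mxE ji mulr0.
rewrite !mxE !eqxx/= mulr1 addr0 subr0 /GRing.scale/= !fctE /cst.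
by field; rewrite sqnorm1_neq0.
Qed.

Lemma induced_stereoE n b (y : 'rV[R]_n) :
  induced_metric (stereo b) y = (4 / (1 + sqnorm y) ^+ 2)%:M.
Proof.
apply/matrixP => i j; rewrite !mxE big_split_ord/= big_ord1.
rewrite !partial_stereor; under eq_bigr do rewrite !partial_stereol.
set q := 1 + sqnorm y.
have q0 : q != 0 by exact: sqnorm1_neq0.
have -> : \sum_(k < n)
    (2 * (k == i)%:R / q - 4 * y 0 i * y 0 k / q ^+ 2) *
    (2 * (k == j)%:R / q - 4 * y 0 j * y 0 k / q ^+ 2) =
    4 / q ^+ 2 * (i == j)%:R - 16 * y 0 i * y 0 j / q ^+ 3 +
    16 * y 0 i * y 0 j / q ^+ 4 * sqnorm y.
  transitivity (\sum_(k < n) (4 / q ^+ 2 * ((k == i)%:R * (k == j)%:R)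
      - 8 * y 0 j / q ^+ 3 * ((k == i)%:R * y 0 k)
      - 8 * y 0 i / q ^+ 3 * ((k == j)%:R * y 0 k)
      + 16 * y 0 i * y 0 j / q ^+ 4 * (y 0 k ^+ 2))).
    by apply: eq_bigr => k _; field.
  have sumd (l : 'I_n) (F : 'I_n -> R) : \sum_k (k == l)%:R * F k = F l.
    rewrite (bigD1 l)//= big1 ?addr0 ?eqxx ?mul1r// => k /negbTE ->.
    by rewrite mul0r.
  rewrite !big_split/= !sumrN -!mulr_sumr !sumd -/(sqnorm y).
  by field.
rewrite (_ : sqnorm y = q - 1); last by rewrite /q addrAC subrr add0r.
have bb : ((-1) ^+ b) ^+ 2 = 1 :> R by rewrite -exprM mulnC exprM sqrrN !expr1n.
rewrite -[RHS]mulr_natr.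
transitivity (4 / q ^+ 2 * (i == j)%:R - 16 * y 0 i * y 0 j / q ^+ 3 +
  16 * y 0 i * y 0 j / q ^+ 4 * (q - 1) +
  ((-1) ^+ b) ^+ 2 * (16 * y 0 i * y 0 j / q ^+ 4)); first by field.
by rewrite bb; field.
Qed.

Lemma range_stereo n (b : bool) :
  range (@stereo n b) =
  sphere `&` [set p : 'rV[R]_(n + 1) | p 0 (rshift n ord0) != (-1) ^+ b].
Proof.
have e2 : (-1) ^+ b * (-1) ^+ b = 1 :> R.
  by rewrite -expr2 -exprM mulnC exprM sqrrN !expr1n.
have sqE (c : R) (x : 'rV[R]_n) (t : R) :
    sqnorm (c *: row_mx x t%:M : 'rV[R]_(n + 1)) =
    c ^+ 2 * (sqnorm x + t ^+ 2).
  rewrite /sqnorm big_split_ord/= big_ord1 mulrDr mulr_sumr; congr (_ + _).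
    by apply: eq_bigr => i _; rewrite mxE row_mxEl exprMn.
  by rewrite mxE row_mxEr mxE eqxx mulr1n exprMn.
have sqZ (c : R) (x : 'rV[R]_n) : sqnorm (c *: x) = c ^+ 2 * sqnorm x.
  by rewrite /sqnorm mulr_sumr; apply: eq_bigr => i _; rewrite mxE exprMn.
apply/seteqP; split => [_ [y _ <-]|p].
  have q0 := sqnorm1_neq0 y; split => /=.
    rewrite /sphere/= /stereo sqE sqZ exprMn expr2 [_ ^+ b ^+ 2]expr2 e2.
    by field.
  rewrite mxE row_mxEr mxE eqxx mulr1n; apply/eqP => /(congr1 ( *%R ((-1) ^+ b))).
  rewrite mulrCA (mulrA ((-1) ^+ b)) e2 mul1r => H.
  have : sqnorm y - 1 = 1 + sqnorm y.
    by apply: (mulIf (invr_neq0 q0)); rewrite mulfV// mulrC.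
  by move/eqP; rewrite -subr_eq0 => /eqP; lra.
move=> [/= ps]; set t := p 0 _ => tb.
pose d := 1 - (-1) ^+ b * t.
have d0 : d != 0.
  apply: contra tb => /eqP d0; apply/eqP.
  have : (-1) ^+ b * t = 1 by move: d0; rewrite /d; lra.
  by move=> /(congr1 ( *%R ((-1) ^+ b))); rewrite mulrA e2 mul1r mulr1.
have pE : p = row_mx (lsubmx p) t%:M.
  rewrite -[LHS]hsubmxK; congr row_mx; apply/rowP => i.
  by rewrite !mxE !ord1 eqxx mulr1n.
have sl : sqnorm (lsubmx p) = 1 - t ^+ 2.
  by move: ps; rewrite /sphere/= {1}pE -[row_mx _ _]scale1r sqE => <-; ring.
pose y := d^-1 *: lsubmx p.
have tt : t ^+ 2 = ((-1) ^+ b * t) ^+ 2.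
  by rewrite exprMn [_ ^+ b ^+ 2]expr2 e2 mul1r.
have yE : sqnorm y = ((-1) ^+ b * t + 1) / d.
  rewrite /y sqZ sl tt; move: d0; rewrite /d; set z := _ * t => d0.
  by field.
exists y => //; rewrite /stereo yE [RHS]pE.
have ed : (-1) ^+ b * t = 1 - d by rewrite /d; lra.
have -> : (1 + ((-1) ^+ b * t + 1) / d)^-1 = d / 2.
  by rewrite -[RHS]invf_div; congr _^-1; rewrite ed; field.
rewrite scale_row_mx; congr row_mx.
  rewrite /y !scalerA (_ : _ * _ = 1) ?scale1r//; by field.
apply/rowP => i; rewrite !mxE !ord1 eqxx !mulr1n.
rewrite mulrCA; have -> : d / 2 * (((-1) ^+ b * t + 1) / d - 1) = (-1) ^+ b * t.
  by rewrite ed; field.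
by rewrite mulrA e2 mul1r.
Qed.

End models.

(* Image under psi of the measure sqrt(det g) dx on the chart domain U.     *)
Definition chart_volume {R : realType} {n d} {T : measurableType d}
    (U : set 'rV[R]_n) (g : 'rV[R]_n -> 'M[R]_n) (psi : 'rV[R]_n -> T) :
    set T -> \bar R :=
  fun A => (\int[lebesgue_rV n]_(x in U `&` psi @^-1` A)
              (volume_density g x)%:E)%E.

Section chart_volume_theory.
Context {R : realType} {n : nat} {d} {T : measurableType d}.
Variables (U : set 'rV[R]_n) (g : 'rV[R]_n -> 'M[R]_n) (psi : 'rV[R]_n -> T).
Hypothesis mU : measurable U.
Hypothesis mg : measurable_fun setT (volume_density g).
Hypothesis mpsi : measurable_fun setT psi.
Local Notation V := (chart_volume U g psi).

Lemma volume_density_ge0 x : 0 <= volume_density g x.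
Proof. exact: sqrtr_ge0. Qed.

Lemma chart_volume0 : V set0 = 0%E.
Proof. by rewrite /chart_volume preimage_set0 setI0 integral_set0. Qed.

Lemma chart_volume_ge0 A : (0 <= V A)%E.
Proof.
by apply: integral_ge0 => x _; rewrite lee_fin volume_density_ge0.
Qed.

Lemma chart_volume_sigma_additive : semi_sigma_additive V.
Proof.
move=> F mF tF mUF; rewrite /chart_volume; apply: cvg_toP.
  apply: ereal_nondecreasing_is_cvgn => p q pq.
  apply: lee_sum_nneg_natr => // k _ _.
  exact: chart_volume_ge0.
rewrite preimage_bigcup setI_bigcupr ge0_integral_bigcup//=.
- move=> k; apply: measurableI => //.
  by rewrite -[X in measurable X]setTI; exact: mpsi.
- apply: (@measurable_funS _ _ _ _ setT) => //; exact/measurable_EFinP.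
- by move=> x _; rewrite lee_fin volume_density_ge0.
- apply/trivIsetP => i j _ _ ij.
  rewrite setIACA setIid -preimage_setI.
  by move/trivIsetP : tF => /(_ i j Logic.I Logic.I ij) ->;
    rewrite preimage_set0 setI0.
Qed.

End chart_volume_theory.

(* Points of the product of the hyperbolic m-space and the unit 2-sphere    *)
(* are pairs in R^m x R^3; functions and measures live on this ambient type *)
(* and only matter on the subset hyp_sphere.  The atlas has two charts, one *)
(* for each stereographic parametrization of the sphere, both with domain   *)
(* half_space x R^2; local notions are required in both charts.             *)

Section hyp_sphere.
Context {R : realType}.
Variable m : nat.
Local Notation point := ('rV[R]_m.-1.+1 * 'rV[R]_(2 + 1))%type.

Definition hyp_sphere : set point := half_space `*` sphere.

Definition hyp_sphere_dom : set 'rV[R]_(m.-1.+1 + 2) :=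
  [set x | half_space (lsubmx x)].

Definition hyp_sphere_chart (b : bool) (x : 'rV[R]_(m.-1.+1 + 2)) : point :=
  (lsubmx x, stereo b (rsubmx x)).

Definition hyp_sphere_metric (b : bool) :
    'rV[R]_(m.-1.+1 + 2) -> 'M[R]_(m.-1.+1 + 2) :=
  product_metric hyperbolic_metric (induced_metric (stereo b)).

Definition hyp_sphere_smooth (u : point -> R) :=
  forall b, smooth_on hyp_sphere_dom (u \o hyp_sphere_chart b).

Definition hyp_sphere_conformal_laplacian (b : bool) (u : point -> R) :
    'rV[R]_(m.-1.+1 + 2) -> R :=
  conformal_laplacian (hyp_sphere_metric b) (u \o hyp_sphere_chart b).

Lemma measurable_half_space : measurable (@half_space R m).
Proof.
rewrite (_ : half_space = (fun x : 'rV[R]_m.-1.+1 => x 0 ord_max : R) @^-1`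
  `]0, +oo[).
  rewrite -[X in measurable X]setTI.
  have mc := @measurable_coord_rV R m.-1.+1 ord_max.
  by apply: mc => //; exact: measurable_itv.
by apply/seteqP; split => x /=; rewrite in_itv/= andbT.
Qed.

Lemma measurable_lsubmx n k :
  measurable_fun setT (fun x : 'rV[R]_(n + k) => lsubmx x).
Proof.
apply: measurable_fun_rV => i.
rewrite (_ : (fun _ => _) = fun x : 'rV[R]_(n + k) => x 0 (lshift k i) : R).
  exact: measurable_coord_rV.
by apply/funext => x; rewrite mxE.
Qed.

Lemma measurable_rsubmx n k :
  measurable_fun setT (fun x : 'rV[R]_(n + k) => rsubmx x).
Proof.
apply: measurable_fun_rV => i.
rewrite (_ : (fun _ => _) = fun x : 'rV[R]_(n + k) => x 0 (rshift n i) : R).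
  exact: measurable_coord_rV.
by apply/funext => x; rewrite mxE.
Qed.

Lemma measurable_sqnorm n : measurable_fun setT (@sqnorm R n).
Proof.
apply: measurable_sum => i; apply: measurable_funX.
exact: measurable_coord_rV.
Qed.

Lemma measurable_inv_ge0 d (T : measurableType d) (f : T -> R) :
  (forall x, 0 <= f x) -> measurable_fun setT f ->
  measurable_fun setT (fun x => (f x)^-1).
Proof.
move=> f0 mf; rewrite (_ : (fun _ => _) = (@powR R)^~ (-1) \o f).
  by apply: measurableT_comp => //; exact: measurable_powR.
by apply/funext => x /=; rewrite powR_inv1.
Qed.

Lemma measurable_stereo n b : measurable_fun setT (@stereo R n b).
Proof.
apply: measurable_fun_rV => i; rewrite /stereo.
have mV : measurable_fun setT (fun x : 'rV[R]_n => (1 + sqnorm x)^-1).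
  apply: measurable_inv_ge0 => [x|]; first by rewrite addr_ge0// sqnorm_ge0.
  by apply: measurable_funD => //; exact: measurable_sqnorm.
case: (split_ordP i) => j ->.
- rewrite (_ : (fun _ => _) = fun x => (1 + sqnorm x)^-1 * (2 * x 0 j)).
    apply: measurable_funM => //; apply: measurable_funM => //.
    exact: measurable_coord_rV.
  by apply/funext => x; rewrite mxE row_mxEl mxE.
- rewrite (_ : (fun _ => _) =
      fun x => (1 + sqnorm x)^-1 * ((-1) ^+ b * (sqnorm x - 1))).
    apply: measurable_funM => //; apply: measurable_funM => //.
    by apply: measurable_funB => //; exact: measurable_sqnorm.
  by apply/funext => x; rewrite mxE row_mxEr mxE ord1 eqxx mulr1n.
Qed.

Lemma measurable_hyp_sphere_dom : measurable hyp_sphere_dom.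
Proof.
rewrite -[X in measurable X]setTI; apply: measurable_lsubmx => //.
exact: measurable_half_space.
Qed.

Lemma measurable_hyp_sphere_chart b :
  measurable_fun setT (hyp_sphere_chart b).
Proof.
apply/measurable_fun_pairP; split; first exact: measurable_lsubmx.
apply: (measurableT_comp (measurable_stereo _)); exact: measurable_rsubmx.
Qed.

Lemma hyp_sphere_volume_densityE b x :
  volume_density (hyp_sphere_metric b) x =
  Num.sqrt ((lsubmx x 0 ord_max ^- 2) ^+ m.-1.+1 *
            (4 / (1 + sqnorm (rsubmx x)) ^+ 2) ^+ 2).
Proof.
by rewrite /volume_density det_ublock induced_stereoE !det_scalar.
Qed.

Lemma measurable_hyp_sphere_volume_density b :
  measurable_fun setT (volume_density (hyp_sphere_metric b)).
Proof.
pose f (x : 'rV[R]_(m.-1.+1 + 2)) := (lsubmx x 0 ord_max ^- 2) ^+ m.-1.+1 *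
  (4 / (1 + sqnorm (rsubmx x)) ^+ 2) ^+ 2.
rewrite (_ : volume_density _ = (@powR R)^~ 2^-1 \o f).
  apply: measurableT_comp; first exact: measurable_powR.
  apply: measurable_funM; apply: measurable_funX.
    apply: measurable_inv_ge0 => [x|]; first exact: sqr_ge0.
    apply: measurable_funX.
    apply: (measurableT_comp (measurable_coord_rV ord_max)).
    exact: measurable_lsubmx.
  apply: measurable_funM => //.
  apply: measurable_inv_ge0 => [x|]; first exact: sqr_ge0.
  apply: measurable_funX; apply: measurable_funD => //.
  apply: (measurableT_comp (@measurable_sqnorm 2)).
  exact: measurable_rsubmx.
apply/funext => x; rewrite hyp_sphere_volume_densityE /= powR12_sqrt//.
rewrite /f mulr_ge0// exprn_ge0// ?invr_ge0 ?sqr_ge0//.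
by rewrite divr_ge0// sqr_ge0.
Qed.

Definition hyp_sphere_chart_volume (b : bool) : set point -> \bar R :=
  chart_volume hyp_sphere_dom (hyp_sphere_metric b) (hyp_sphere_chart b).

HB.instance Definition _ b := isMeasure.Build _ _ _ (hyp_sphere_chart_volume b)
  (chart_volume0 _ _ _) (chart_volume_ge0 _ _ _)
  (chart_volume_sigma_additive measurable_hyp_sphere_dom
    (measurable_hyp_sphere_volume_density b)
    (measurable_hyp_sphere_chart b)).

Definition north_fiber : set point := [set p : point | p.2 0 (rshift 2 ord0) = 1].

Lemma measurable_north_fiber : measurable north_fiber.
Proof.
rewrite (_ : north_fiber =
  ((fun x : 'rV[R]_(2 + 1) => x 0 (rshift 2 ord0) : R) \o snd) @^-1` [set 1]).
  rewrite -[X in measurable X]setTI; apply: measurableT_comp => //.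
  exact: measurable_coord_rV.
by [].
Qed.

(* The chart b = false covers everything but north_fiber, which is measured *)
(* in the other chart.                                                      *)
Definition hyp_sphere_volume : {measure set point -> \bar R} :=
  measure_add (hyp_sphere_chart_volume false)
    (mrestr (hyp_sphere_chart_volume true) measurable_north_fiber).

End hyp_sphere.

(* Main.v *)
Require Import Defs.
From mathcomp Require Import all_boot all_order all_algebra.
From mathcomp Require Import all_classical all_reals all_analysis.
From mathcomp Require Import measurable_realfun ess_sup_inf ring lra.
Set Implicit Arguments.
Unset Strict Implicit.
Unset Printing Implicit Defensive.
Import Order.TTheory GRing.Theory Num.Theory.
Import numFieldNormedType.Exports.
Local Open Scope classical_set_scope.
Local Open Scope ring_scope.

(* Let m = n - 2 and c = (m - 2) / 2.  The solution depends on the hyperbolic *)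
(* factor only; in the upper half-space it is                                 *)
(*   v = (y / |x + e|^2)^c, with y the last coordinate and e its unit vector, *)
(* that is y^c times the Newton potential |x + e|^(2 - m) of the point - e    *)
(* outside the half-space.  The conformal invariance of the conformal         *)
(* Laplacian of the hyperbolic space turns the harmonicity of this potential  *)
(* into Delta v = c (c + 1) v, and the scalar curvature - m (m - 1) + 2 of    *)
(* the product makes this L u = 0.  The volume density is y^(-m) on the       *)
(* hyperbolic factor, so v^2 y^(-m) ~ y^(-2) near y = 0 is not integrable,    *)
(* whereas v^(p_n) y^(-m) = y^(-4/m) |x + e|^(-2 (m - 4/m)) is dominated by a *)
(* product of integrable functions of one variable as soon as m > 4.          *)

(** * Smooth functions *)

(** The function v above is an eigenfunction of the hyperbolic Laplacian, and its eigenvalue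
    balances the curvature: a_n c (c + 1) = (m + 1) (m - 2) = m (m - 1) - 2, the opposite of the
    scalar curvature of the product. The rest is a matter of decay. The pole - e is outside the
    closed half-space, so |x + e| >= 1 there and v is smooth and bounded by 1. Near y = 0 it behaves
    like y^c against the volume y^(-m) dy, so v^s is integrable there exactly when c s > m - 1. For
    s = 2 one has c s = m - 2, which fails; for s = p_n one has c s = m - 4/m, which works as soon
    as m > 4, that is n >= 7. The sphere contributes only its finite area and its curvature 2.

    The equation is [hyp_sphere_conformal_laplacian_pole_power]: it combines [laplacian_product] and
    [scalar_curvature_product] with the eigenvalue [laplacian_hyperbolic_pole_power] and the
    curvatures of the factors, both instances of [scalar_curvature_conformally_flat]. Smoothness is
    [elementary_smooth]. Integrability ([Lfun_pole_power]) compares the integrand in each chart with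
    a product of one-variable functions; [notin_Lfun2_pole_power] bounds the square integral below
    on thin boxes. *)

Lemma open_near {T : topologicalType} (U : set T) (P : T -> Prop) x :
  open U -> U x -> (forall z, U z -> P z) -> \near x, P x.
Proof. by move=> oU Ux UP; near do apply: UP; exact: open_nbhs_nbhs.
Unshelve. all: by end_near. Qed.

(** The first-order expansion of [f] at [x] is also one of [g], and the differential is determined
    by such an expansion. This serves to replace functions by formulas valid on an open set only. *)
Lemma near_eq_differentiable {R : realType} {V W : normedModType R} (f g : V -> W) x :
  (\near x, f x = g x) -> differentiable f x -> differentiable g x.
Proof.
move=> fg df; have /diff_locallyP[dc dE] := df.
have fgx : f x = g x by exact: (nbhs_singleton fg).
have gE : g \o shift x = cst (g x) + 'd f x +o_ 0 id.
  apply/eqaddoP => e e0; have /eqaddoP/(_ e e0) := dE.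
  have : \forall y \near (0 : V), f (y + x) = g (y + x).
    move: fg; rewrite (near_shift 0 x) /=; apply: filterS => y /=.
    by rewrite subr0.
  apply: filterS2 => y /=.
  by rewrite !fctE /= /cst fgx => ->.
have ddE := @diff_unique _ _ _ _ _ _ dc gE.
by apply/diff_locallyP; rewrite ddE.
Qed.

Section powR_comp.
Context {R : realType} {V : normedModType R}.
Implicit Types f : V -> R.

Lemma differentiable_powR f a x : 0 < f x ->
  differentiable f x -> differentiable (fun z => f z `^ a) x.
Proof.
move=> f0 df; apply: (@differentiable_comp _ _ _ _ f (@powR R ^~ a)) => //.
by apply/derivable1_diffP; exact: (@ex_derive _ _ _ _ _ _ _ (is_derive1_powR a f0)).
Qed.

Lemma derive_powR f a x v : 0 < f x -> differentiable f x ->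
  'D_v (fun z => f z `^ a) x = a * f x `^ (a - 1) * 'D_v f x.
Proof.
move=> f0 df; have dp := is_derive1_powR a f0.
have ddp : differentiable (@powR R ^~ a) (f x).
  by apply/derivable1_diffP; exact: (@ex_derive _ _ _ _ _ _ _ dp).
rewrite deriveE; last exact: differentiable_powR.
rewrite (@diff_comp _ _ _ _ f (@powR R ^~ a)) //= -(deriveE _ df).
rewrite -[X in 'd _ _ X]mulr1 -[_ * 1]/(_ *: (1 : R)) linearZ /=.
rewrite -(deriveE _ ddp) (@derive_val _ _ _ _ _ _ _ dp).
by rewrite /GRing.scale/= mulrC.
Qed.

End powR_comp.

Section elementary.
Context {R : realType} {n : nat} (U : set 'rV[R]_n).

(* This class is closed under partial derivatives on U, up to values off U. *)
Inductive elementary : ('rV[R]_n -> R) -> Prop :=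
| elementary_cst c : elementary (fun _ => c)
| elementary_coord i : elementary (fun x => x 0 i)
| elementaryD f g : elementary f -> elementary g ->
    elementary (fun x => f x + g x)
| elementaryM f g : elementary f -> elementary g ->
    elementary (fun x => f x * g x)
| elementary_powR f a : elementary f -> (forall x, U x -> 0 < f x) ->
    elementary (fun x => f x `^ a).

Lemma elementary_differentiable f x : elementary f -> U x -> differentiable f x.
Proof.
move=> ef Ux; elim: ef => [c|i|f' g _ df _ dg|f' g _ df _ dg|f' a _ df f0].
- exact: differentiable_cst.
- exact: differentiable_coord.
- exact: differentiableD.
- exact: differentiableM.
- by apply: differentiable_powR => //; exact: f0.
Qed.

Lemma elementary_partial f i : elementary f ->
  exists2 g, elementary g & forall x, U x -> partial i f x = g x.
Proof.
elim=> [c|j|f' g ef [f1 ef1 pf] eg [g1 eg1 pg]|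
  f' g ef [f1 ef1 pf] eg [g1 eg1 pg]|f' a ef [f1 ef1 pf] f0].
- by exists (fun _ => 0) => [|x _]; [exact: elementary_cst|exact: derive_cst].
- exists (fun _ => (delta_mx 0 i : 'rV[R]_n) 0 j); first exact: elementary_cst.
  by move=> x _; exact: (@derive_val _ _ _ _ _ _ _ (derive_coord _ _ _)).
- exists (fun x => f1 x + g1 x); first exact: elementaryD.
  move=> x Ux; rewrite -pf// -pg//; apply: deriveD;
    by apply: diff_derivable; exact: elementary_differentiable.
- exists (fun x => f' x * g1 x + g x * f1 x).
    by apply: elementaryD; exact: elementaryM.
  move=> x Ux; rewrite -pf// -pg//; apply: deriveM;
    by apply: diff_derivable; exact: elementary_differentiable.
- exists (fun x => a * f' x `^ (a - 1) * f1 x).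
    apply: elementaryM => //; apply: elementaryM; first exact: elementary_cst.
    exact: elementary_powR.
  move=> x Ux; rewrite -pf//; apply: derive_powR; first exact: f0.
  exact: elementary_differentiable.
Qed.

(** By induction on the list of indices, an iterated partial derivative agrees on [U] with an
    elementary function; as [U] is open, it inherits differentiability from it. *)
Lemma elementary_smooth f : open U -> elementary f -> smooth_on U f.
Proof.
move=> oU ef s x Ux.
suff [g eg fg] : exists2 g, elementary g & forall x, U x -> foldr partial f s x = g x.
  apply: (@near_eq_differentiable _ _ _ g); last exact: elementary_differentiable.
  by apply: (open_near oU) => // z Uz; exact/esym/fg.
elim: s {x Ux} => [|i s [g eg fg]]; first by exists f.
have [h eh gh] := elementary_partial i eg; exists h => // x Ux /=.
rewrite -gh//; apply: near_eq_derive.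
by apply: (open_near oU).
Qed.

End elementary.

(** * Curvature and Laplacian of a product metric *)

Section derive_linear.
Context {R : realType} {V W V' : normedModType R}.
Variables (L : {linear V -> W}) (f : W -> V').

(** A difference quotient of f o L along v is one of f along L v, so both lemmas below follow by
    rewriting. *)
Let growth_rate x v : (fun h : R => h^-1 *: (((f \o L) \o shift x) (h *: v) - (f \o L) x)) =
  (fun h => h^-1 *: ((f \o shift (L x)) (h *: L v) - f (L x))).
Proof. by apply/funext => h /=; rewrite (linearD L) (linearZ_LR L). Qed.

Lemma derive_linear_comp x v : 'D_v (f \o L) x = 'D_(L v) f (L x).
Proof. by rewrite /derive growth_rate. Qed.

Lemma derivable_linear_comp x v :
  derivable f (L x) (L v) -> derivable (f \o L) x v.
Proof. by rewrite /derivable growth_rate. Qed.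

End derive_linear.

Section partial_submx.
Context {R : realType} {n m : nat}.
Implicit Types (x : 'rV[R]_(n + m)) (i : 'I_n) (j : 'I_m).

Lemma lsubmx_delta_lshift i :
  lsubmx (delta_mx 0 (lshift m i) : 'rV[R]_(n + m)) = delta_mx 0 i.
Proof. by apply/rowP => k; rewrite !mxE eq_lshift. Qed.

Lemma lsubmx_delta_rshift j :
  lsubmx (delta_mx 0 (rshift n j) : 'rV[R]_(n + m)) = 0.
Proof. by apply/rowP => k; rewrite !mxE eq_lrshift andbF. Qed.

Lemma rsubmx_delta_lshift i :
  rsubmx (delta_mx 0 (lshift m i) : 'rV[R]_(n + m)) = 0.
Proof. by apply/rowP => k; rewrite !mxE eq_rlshift andbF. Qed.

Lemma rsubmx_delta_rshift j :
  rsubmx (delta_mx 0 (rshift n j) : 'rV[R]_(n + m)) = delta_mx 0 j.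
Proof. by apply/rowP => k; rewrite !mxE eq_rshift. Qed.

Lemma partial_lsubmx_l (f : 'rV[R]_n -> R) i x :
  partial (lshift m i) (f \o lsubmx) x = partial i f (lsubmx x).
Proof. by rewrite /partial derive_linear_comp /= lsubmx_delta_lshift. Qed.

Lemma partial_lsubmx_r (f : 'rV[R]_n -> R) j x :
  partial (rshift n j) (f \o lsubmx) x = 0.
Proof. by rewrite /partial derive_linear_comp /= lsubmx_delta_rshift derive0. Qed.

Lemma partial_rsubmx_l (f : 'rV[R]_m -> R) i x :
  partial (lshift m i) (f \o rsubmx) x = 0.
Proof. by rewrite /partial derive_linear_comp /= rsubmx_delta_lshift derive0. Qed.

Lemma partial_rsubmx_r (f : 'rV[R]_m -> R) j x :
  partial (rshift n j) (f \o rsubmx) x = partial j f (rsubmx x).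
Proof. by rewrite /partial derive_linear_comp /= rsubmx_delta_rshift. Qed.

Lemma partial0 (i : 'I_(n + m)) x : partial i (fun=> 0) x = 0.
Proof. exact: derive_cst. Qed.

Definition partialE := (partial_lsubmx_l, partial_lsubmx_r, partial_rsubmx_l,
  partial_rsubmx_r, partial0).

End partial_submx.

Section product_metric.
Context {R : realType} {n m : nat}.
Variables (g : 'rV[R]_n -> 'M[R]_n) (h : 'rV[R]_m -> 'M[R]_m).
Variable U : set 'rV[R]_(n + m).
Hypothesis oU : open U.
Hypothesis gU : forall x, U x -> g (lsubmx x) \in unitmx.
Hypothesis hU : forall x, U x -> h (rsubmx x) \in unitmx.
Local Notation gh := (product_metric g h).

Lemma metric_inv_product x : U x ->
  invmx (gh x) = block_mx (invmx (g (lsubmx x))) 0 0 (invmx (h (rsubmx x))).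
Proof.
move=> Ux; rewrite /product_metric invmx_block_diag//.
by rewrite unitmxE det_ublock unitrM -!unitmxE gU// hU.
Qed.

Lemma metric_inv_product_ll i j x : U x ->
  metric_inv gh (lshift m i) (lshift m j) x = metric_inv g i j (lsubmx x).
Proof. by move=> Ux; rewrite /metric_inv metric_inv_product// block_mxEul. Qed.

Lemma metric_inv_product_lr i j x : U x ->
  metric_inv gh (lshift m i) (rshift n j) x = 0.
Proof. by move=> Ux; rewrite /metric_inv metric_inv_product// block_mxEur mxE. Qed.

Lemma metric_inv_product_rl i j x : U x ->
  metric_inv gh (rshift n i) (lshift m j) x = 0.
Proof. by move=> Ux; rewrite /metric_inv metric_inv_product// block_mxEdl mxE. Qed.

Lemma metric_inv_product_rr i j x : U x ->
  metric_inv gh (rshift n i) (rshift n j) x = metric_inv h i j (rsubmx x).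
Proof. by move=> Ux; rewrite /metric_inv metric_inv_product// block_mxEdr. Qed.

Definition metric_inv_productE := (metric_inv_product_ll, metric_inv_product_lr,
  metric_inv_product_rl, metric_inv_product_rr).

Lemma product_metric_ll i j :
  (fun z => gh z (lshift m i) (lshift m j)) = (fun z => g z i j) \o lsubmx.
Proof. by apply/funext => z; rewrite /product_metric block_mxEul. Qed.

Lemma product_metric_lr i j :
  (fun z => gh z (lshift m i) (rshift n j)) = fun=> 0.
Proof. by apply/funext => z; rewrite /product_metric block_mxEur mxE. Qed.

Lemma product_metric_rl i j :
  (fun z => gh z (rshift n i) (lshift m j)) = fun=> 0.
Proof. by apply/funext => z; rewrite /product_metric block_mxEdl mxE. Qed.

Lemma product_metric_rr i j :
  (fun z => gh z (rshift n i) (rshift n j)) = (fun z => h z i j) \o rsubmx.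
Proof. by apply/funext => z; rewrite /product_metric block_mxEdr. Qed.

Definition product_metricE := (product_metric_ll, product_metric_lr,
  product_metric_rl, product_metric_rr).

(** An explicit stand-in for the Christoffel symbols of the product. They agree on [U] only, but
    this one can be differentiated block by block, each block being zero or a function of one
    factor. *)
Definition christoffel_block (k i j : 'I_(n + m)) (x : 'rV[R]_(n + m)) : R :=
  match fintype.split k, fintype.split i, fintype.split j with
  | inl k', inl i', inl j' => christoffel g k' i' j' (lsubmx x)
  | inr k', inr i', inr j' => christoffel h k' i' j' (rsubmx x)
  | _, _, _ => 0
  end.

(** The mixed components of the metric and of its inverse vanish, and the metric of each factor is
    constant along the other factor. *)
Lemma christoffel_product k i j x : U x ->
  christoffel gh k i j x = christoffel_block k i j x.
Proof.
move=> Ux; rewrite /christoffel_block /christoffel big_split_ord/=.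
case: (split_ordP k) => k' ->; case: (split_ordP i) => i' ->;
  case: (split_ordP j) => j' ->;
  (under eq_bigr do rewrite metric_inv_productE// !product_metricE !partialE
     ?(addr0, subr0, mulr0, mul0r));
  (under [X in _ + X]eq_bigr do rewrite metric_inv_productE// !product_metricE
     !partialE ?(addr0, subr0, mulr0, mul0r));
  rewrite ?big1_eq ?addr0 ?add0r ?mulr0 //.
Qed.

Lemma partial_christoffel_product a k i j x : U x ->
  partial a (christoffel gh k i j) x = partial a (christoffel_block k i j) x.
Proof.
move=> Ux; apply: near_eq_derive; apply: (open_near oU) => // z Uz.
exact: christoffel_product.
Qed.

Lemma christoffel_block_lll k i j :
  christoffel_block (lshift m k) (lshift m i) (lshift m j) =
  christoffel g k i j \o lsubmx.
Proof. by apply/funext => x; rewrite /christoffel_block !(unsplitK (inl _)). Qed.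

Lemma christoffel_block_rrr k i j :
  christoffel_block (rshift n k) (rshift n i) (rshift n j) =
  christoffel h k i j \o rsubmx.
Proof. by apply/funext => x; rewrite /christoffel_block !(unsplitK (inr _)). Qed.

Lemma christoffel_block_rll k i j :
  christoffel_block (rshift n k) (lshift m i) (lshift m j) = fun=> 0.
Proof.
by apply/funext => x; rewrite /christoffel_block ?(unsplitK (inl _)) ?(unsplitK (inr _)).
Qed.

Lemma christoffel_block_lrr k i j :
  christoffel_block (lshift m k) (rshift n i) (rshift n j) = fun=> 0.
Proof.
by apply/funext => x; rewrite /christoffel_block ?(unsplitK (inl _)) ?(unsplitK (inr _)).
Qed.

Lemma christoffel_block_rlr k i j :
  christoffel_block (rshift n k) (lshift m i) (rshift n j) = fun=> 0.
Proof.
by apply/funext => x; rewrite /christoffel_block ?(unsplitK (inl _)) ?(unsplitK (inr _)).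
Qed.

Lemma christoffel_block_lrl k i j :
  christoffel_block (lshift m k) (rshift n i) (lshift m j) = fun=> 0.
Proof.
by apply/funext => x; rewrite /christoffel_block ?(unsplitK (inl _)) ?(unsplitK (inr _)).
Qed.

Lemma christoffel_block_llr k i j :
  christoffel_block (lshift m k) (lshift m i) (rshift n j) = fun=> 0.
Proof.
by apply/funext => x; rewrite /christoffel_block ?(unsplitK (inl _)) ?(unsplitK (inr _)).
Qed.

Lemma christoffel_block_rrl k i j :
  christoffel_block (rshift n k) (rshift n i) (lshift m j) = fun=> 0.
Proof.
by apply/funext => x; rewrite /christoffel_block ?(unsplitK (inl _)) ?(unsplitK (inr _)).
Qed.

Definition christoffel_blockE := (christoffel_block_lll, christoffel_block_rrr,
  christoffel_block_rll, christoffel_block_lrr, christoffel_block_rlr,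
  christoffel_block_lrl, christoffel_block_llr, christoffel_block_rrl).

Let ricciE i j x : U x -> ricci gh i j x =
   \sum_k (partial k (christoffel_block k i j) x
             - partial j (christoffel_block k i k) x)
    + \sum_k \sum_l (christoffel_block k k l x * christoffel_block l i j x
                     - christoffel_block k j l x * christoffel_block l i k x).
Proof.
move=> Ux; rewrite /ricci; congr (_ + _).
  by apply: eq_bigr => k _; rewrite !partial_christoffel_product.
by apply: eq_bigr => k _; apply: eq_bigr => l _; rewrite !christoffel_product.
Qed.

Lemma ricci_product_ll i j x : U x ->
  ricci gh (lshift m i) (lshift m j) x = ricci g i j (lsubmx x).
Proof.
move=> Ux; rewrite ricciE// /ricci !big_split_ord/=.
under eq_bigr do rewrite !christoffel_blockE !partialE.
under [X in _ + X + _]eq_bigr do rewrite !christoffel_blockE !partialE subr0.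
rewrite big1_eq addr0; congr (_ + _).
rewrite [X in _ + X]big1 ?addr0 => [|k _]; last first.
  rewrite big_split_ord/=.
  under eq_bigr do rewrite !christoffel_blockE !mul0r subr0.
  under [X in _ + X]eq_bigr do rewrite !christoffel_blockE !(mulr0, mul0r) subr0.
  by rewrite !big1_eq addr0.
apply: eq_bigr => k _; rewrite big_split_ord/=.
under eq_bigr do rewrite !christoffel_blockE /=.
under [X in _ + X]eq_bigr do rewrite !christoffel_blockE !(mulr0, mul0r) subr0.
by rewrite big1_eq addr0.
Qed.

Lemma ricci_product_rr i j x : U x ->
  ricci gh (rshift n i) (rshift n j) x = ricci h i j (rsubmx x).
Proof.
move=> Ux; rewrite ricciE// /ricci !big_split_ord/=.
under eq_bigr do rewrite !christoffel_blockE !partialE subr0.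
under [X in _ + X + _]eq_bigr do rewrite !christoffel_blockE !partialE.
rewrite big1_eq add0r; congr (_ + _).
rewrite [X in X + _]big1 ?add0r => [|k _]; last first.
  rewrite big_split_ord/=.
  under eq_bigr do rewrite !christoffel_blockE !(mulr0, mul0r) subr0.
  under [X in _ + X]eq_bigr do rewrite !christoffel_blockE !(mulr0, mul0r) subr0.
  by rewrite !big1_eq addr0.
apply: eq_bigr => k _; rewrite big_split_ord/=.
under eq_bigr do rewrite !christoffel_blockE !(mulr0, mul0r) subr0.
under [X in _ + X]eq_bigr do rewrite !christoffel_blockE /=.
by rewrite big1_eq add0r.
Qed.

(** The inverse metric is block diagonal, so only the two diagonal blocks of the Ricci tensor are
    traced. *)
Lemma scalar_curvature_product x : U x -> scalar_curvature gh x =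
  scalar_curvature g (lsubmx x) + scalar_curvature h (rsubmx x).
Proof.
move=> Ux; rewrite /scalar_curvature big_split_ord/=; congr (_ + _);
  apply: eq_bigr => i _; rewrite big_split_ord/=.
- rewrite [X in _ + X]big1 ?addr0 => [|j _]; last by rewrite metric_inv_productE// mul0r.
  by apply: eq_bigr => j _; rewrite metric_inv_productE// ricci_product_ll.
- rewrite [X in X + _]big1 ?add0r => [|j _]; last by rewrite metric_inv_productE// mul0r.
  by apply: eq_bigr => j _; rewrite metric_inv_productE// ricci_product_rr.
Qed.

Hypothesis g_ge0 : forall x, U x -> 0 <= \det (g (lsubmx x)).
Hypothesis h_gt0 : forall x, U x -> 0 < \det (h (rsubmx x)).

Lemma volume_density_product x : U x -> volume_density gh x =
  volume_density g (lsubmx x) * volume_density h (rsubmx x).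
Proof.
by move=> Ux; rewrite /volume_density det_ublock sqrtrM// g_ge0.
Qed.

(** The gradient of a function of the first factor has no component along the second. The density of
    the second factor is constant along the first, so it comes out of the divergence and cancels;
    the derivability assumption is what the Leibniz rule asks for. *)
Lemma laplacian_product (f : 'rV[R]_n -> R) x : U x ->
  (forall i, derivable (fun z => volume_density g z * gradient g f i z)
    (lsubmx x) (delta_mx 0 i)) ->
  laplacian gh (f \o lsubmx) x = laplacian g f (lsubmx x).
Proof.
move=> Ux df; rewrite /laplacian; congr (- _).
rewrite /divergence big_split_ord/= [X in _ + X]big1 ?addr0 => [|j _]; last first.
  rewrite -[RHS](partial0 (rshift n j) x); apply: near_eq_derive.
  apply: (open_near oU) => // z Uz; rewrite /gradient big_split_ord/= !big1 ?addr0 ?mulr0//;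
    by move=> i _; rewrite metric_inv_productE// ?mul0r// partialE mulr0.
rewrite volume_density_product//.
have vh0 : volume_density h (rsubmx x) != 0 by rewrite gt_eqF// sqrtr_gt0 h_gt0.
rewrite invfM -mulrA; congr (_ * _).
apply: (mulfI vh0); rewrite mulrA mulfV// mul1r mulr_sumr.
apply: eq_bigr => i _.
pose F z := volume_density g z * gradient g f i z.
transitivity (partial (lshift m i) ((F \o lsubmx) * (volume_density h \o rsubmx)) x).
  apply: near_eq_derive; apply: (open_near oU) => // z Uz; rewrite volume_density_product//.
  rewrite fctE /= /F mulrAC; congr (_ * _ * _).
  rewrite /gradient big_split_ord/= [X in _ + X]big1 ?addr0 => [|j _].
    by apply: eq_bigr => j _; rewrite metric_inv_productE// partialE.
  by rewrite metric_inv_productE// mul0r.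
rewrite /partial deriveM.
- by rewrite -!/(partial _ _ _) !partialE /= /GRing.scale/= mulr0 add0r.
- by apply: derivable_linear_comp => /=; rewrite lsubmx_delta_lshift; exact: df.
- by apply: derivable_linear_comp => /=; rewrite rsubmx_delta_lshift; exact: derivable0.
Qed.

End product_metric.

(** * Conformally flat metrics *)

Lemma sum_delta (R : comPzRingType) n (i : 'I_n) (F : 'I_n -> R) :
  \sum_k (i == k)%:R * F k = F i.
Proof.
rewrite (bigD1 i)//= eqxx mul1r big1 ?addr0// => k /negbTE ki.
by rewrite eq_sym ki mul0r.
Qed.

(* The function a i is half of the i-th logarithmic derivative of the         *)
(* conformal factor phi.                                                      *)
Section conformally_flat.
Context {R : realType} {n : nat}.
Variables (U : set 'rV[R]_n) (phi : 'rV[R]_n -> R) (a : 'I_n -> 'rV[R]_n -> R).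
Hypothesis oU : open U.
Hypothesis phi0 : forall x, U x -> phi x != 0.
Hypothesis phi_a : forall i x, U x -> partial i phi x = 2 * phi x * a i x.
Hypothesis da : forall i x, U x -> derivable (a i) x (delta_mx 0 i).
Local Notation g := (fun x => (phi x)%:M : 'M[R]_n).

Lemma metric_inv_scalar i j x : metric_inv g i j x = (i == j)%:R * (phi x)^-1.
Proof. by rewrite /metric_inv invmx_scalar mxE mulr_natl. Qed.

Let partial_g i j l x : partial i (fun z => g z j l) x = (j == l)%:R * partial i phi x.
Proof.
under [X in partial i X]eq_fun do rewrite mxE.
by case: eqP => _; rewrite ?mul1r ?mul0r //; exact: derive_cst.
Qed.

Let christoffelE k i j x : U x -> christoffel g k i j x =
  (j == k)%:R * a i x + (i == k)%:R * a j x - (i == j)%:R * a k x.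
Proof.
move=> Ux; rewrite /christoffel.
under eq_bigr do rewrite metric_inv_scalar !partial_g -mulrA.
rewrite sum_delta !phi_a//.
by field; exact: phi0.
Qed.

(** The inverse metric is scalar, so only the diagonal of the Ricci tensor is needed, and with it
    only these two kinds of differentiated symbols. *)
Let partial_christoffel_ii k i x : U x -> partial k (christoffel g k i i) x =
  (2 * (i == k)%:R - 1) * partial k (a k) x.
Proof.
move=> Ux.
transitivity (partial k (fun z => (2 * (i == k)%:R - 1) * a k z) x).
  apply: near_eq_derive; apply: (open_near oU) => // z Uz; rewrite christoffelE// eqxx.
  by case: eqP => [->|_] /=; ring.
by apply: deriveZ; exact: da.
Qed.

Let partial_christoffel_ik k i x : U x ->
  partial i (christoffel g k i k) x = partial i (a i) x.
Proof.
move=> Ux; apply: near_eq_derive; apply: (open_near oU) => // z Uz.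
by rewrite christoffelE// eqxx /=; ring.
Qed.

Let S x := \sum_k a k x ^+ 2.
Let T x := \sum_k partial k (a k) x.

Let ricciE i x : U x -> ricci g i i x =
  (2 - n%:R) * partial i (a i) x - T x + (n%:R - 2) * (a i x ^+ 2 - S x).
Proof.
move=> Ux; rewrite /ricci.
have -> : \sum_k (partial k (christoffel g k i i) x - partial i (christoffel g k i k) x) =
  (2 - n%:R) * partial i (a i) x - T x.
  under eq_bigr do rewrite partial_christoffel_ii// partial_christoffel_ik// mulrBl mul1r -mulrA.
  rewrite !big_split/= !sumrN -mulr_sumr sum_delta sumr_const card_ord -mulr_natl.
  by rewrite /T; ring.
congr (_ + _).
(* The quadratic terms are put in a form linear in Kronecker deltas, checked by cases on which of
   [i], [k], [l] coincide; each sum then collapses by [sum_delta]. *)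
transitivity (\sum_k \sum_l ((i == l)%:R * (2 * a i x ^+ 2 + a k x ^+ 2
    - 2 * ((i == k)%:R * a i x ^+ 2)) - (k == l)%:R * a i x ^+ 2
    - a l x ^+ 2 + (i == k)%:R * a l x ^+ 2)).
  apply: eq_bigr => k _; apply: eq_bigr => l _; rewrite !christoffelE// !eqxx.
  case: (eqVneq k l) => [->|kl]; first by case: (eqVneq i l) => [->|il] /=; ring.
  case: (eqVneq i l) => [->|il]; first by rewrite eq_sym (negbTE kl) /=; ring.
  by case: (eqVneq i k) => [->|ik] /=; ring.
under eq_bigr do rewrite !big_split/= !sumrN -mulr_sumr !sum_delta -/(S x).
rewrite !big_split/= !sumrN -mulr_suml sum_delta -!mulr_sumr sum_delta !sumr_const card_ord.
by rewrite -/(S x) -[_ *+ n]mulr_natl -[S x *+ n]mulr_natl -[_ *+ n]mulr_natl; ring.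
Qed.

(** When phi = e^(2f), [a] is the Euclidean gradient of f and this is the classical formula for the
    scalar curvature of e^(2f) times the flat metric. *)
Lemma scalar_curvature_conformally_flat x : U x -> scalar_curvature g x =
  - (n%:R - 1) * (phi x)^-1 *
  (2 * (\sum_k partial k (a k) x) + (n%:R - 2) * \sum_k a k x ^+ 2).
Proof.
move=> Ux; rewrite /scalar_curvature.
under eq_bigr => i _.
  under eq_bigr do rewrite metric_inv_scalar -mulrA.
  rewrite sum_delta ricciE//.
  over.
rewrite -mulr_sumr !big_split/= -!mulr_sumr big_split/= !sumr_const card_ord.
by rewrite -/(S x) -/(T x) -(mulr_natl (- T x)) -(mulr_natl (- S x)); ring.
Qed.

End conformally_flat.

Lemma is_derive_powR_comp {R : realType} {V : normedModType R} (f : V -> R) a x v df :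
  0 < f x -> differentiable f x -> is_derive x v f df ->
  is_derive x v (fun z => f z `^ a) (a * f x `^ (a - 1) * df).
Proof.
move=> f0 diff_f [_ <-]; split; last exact: derive_powR.
by apply: diff_derivable; exact: differentiable_powR.
Qed.

Lemma open_half_space {R : realType} m : open (@half_space R m).
Proof.
rewrite (_ : half_space = (fun x : 'rV[R]_m.-1.+1 => x 0 ord_max) @^-1` [set t | 0 < t]) //.
by apply: open_comp => [x _|]; [exact: coord_continuous|exact: open_gt].
Qed.

(** * Scalar curvatures of the two factors *)

Section hyperbolic.
Context {R : realType} {m : nat}.
Local Notation H := (@half_space R m).
Local Notation d := (m.-1.+1).
Local Notation y := (fun x : 'rV[R]_d => x 0 ord_max).

Lemma scalar_curvature_hyperbolic x : H x ->
  scalar_curvature (@hyperbolic_metric R m) x = - (d%:R * (d%:R - 1)).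
Proof.
move=> Hx; have x0 : y x != 0 by rewrite gt_eqF.
have dy i (z : 'rV[R]_d) : is_derive z (delta_mx 0 i) y (i == ord_max)%:R.
  by have := derive_coord z (delta_mx 0 i) ord_max; rewrite mxE eqxx eq_sym.
have dyV i (z : 'rV[R]_d) : H z ->
    is_derive z (delta_mx 0 i) (fun z => (y z)^-1) (- (i == ord_max)%:R * (y z) ^- 2).
  move=> Hz; have z0 : y z != 0 by rewrite gt_eqF.
  have [dz dzE] := dy i z.
  by split; [exact: derivableV|rewrite deriveV// dzE mulrC /GRing.scale/= mulrN mulNr].
(* Here phi = y^(-2), that is f = - log y. The sum of the derivatives of [a] and the sum of its
   squares are both y^(-2), whence - (d - 1) (2 + (d - 2)). *)
pose a (i : 'I_d) (z : 'rV[R]_d) := - (i == ord_max)%:R * (y z)^-1 : R.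
have da i z : H z -> is_derive z (delta_mx 0 i) (a i) ((i == ord_max)%:R * (y z) ^- 2).
  move=> Hz; apply: is_derive_eq.
    exact: (is_deriveZ (- (i == ord_max)%:R) (dyV i z Hz)).
  by rewrite /GRing.scale/=; case: eqP => _ /=; ring.
rewrite (@scalar_curvature_conformally_flat _ _ H (fun z => y z ^- 2) a) //.
- have -> : \sum_k partial k (a k) x = y x ^- 2.
    under eq_bigr do rewrite /partial (@derive_val _ _ _ _ _ _ _ (da _ _ Hx)).
    rewrite -[RHS](@sum_delta R d ord_max (fun=> y x ^- 2)).
    by apply: eq_bigr => i _; rewrite eq_sym.
  have -> : \sum_k a k x ^+ 2 = y x ^- 2.
    rewrite -[RHS](@sum_delta R d ord_max (fun=> y x ^- 2)).
    by apply: eq_bigr => i _; rewrite /a eq_sym; case: eqP => _ /=; field.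
  by field.
- exact: open_half_space.
- by move=> z Hz; rewrite invr_neq0// expf_neq0// gt_eqF.
- move=> i z Hz; have z0 : y z != 0 by rewrite gt_eqF.
  have := is_deriveX 2 (dyV i z Hz) => /(@derive_val _ _ _ _ _ _ _).
  rewrite (_ : (fun z => _) ^+ 2 = fun z => y z ^- 2); last first.
    by apply/funext => t; rewrite fctE exprVn.
  by rewrite /partial => ->; rewrite /a /GRing.scale/=; field.
- by move=> i z Hz; have [] := da i z Hz.
Qed.

End hyperbolic.

Lemma scalar_curvature_sphere {R : realType} b (x : 'rV[R]_2) :
  scalar_curvature (induced_metric (stereo b)) x = 2.
Proof.
rewrite (_ : induced_metric _ = fun z => (4 / (1 + sqnorm z) ^+ 2)%:M); last first.
  by apply/funext => z; exact: induced_stereoE.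
pose Q (z : 'rV[R]_2) := 1 + sqnorm z.
have Q0 z : Q z != 0 := sqnorm1_neq0 z.
have sumE (z : 'rV[R]_2) i : \sum_j z 0 j * (delta_mx 0 i : 'rV[R]_2) 0 j = z 0 i.
  rewrite -[RHS](@sum_delta R 2 i (fun k => z 0 k)).
  by apply: eq_bigr => k _; rewrite mxE eqxx mulrC eq_sym.
have dQV i (z : 'rV[R]_2) : is_derive z (delta_mx 0 i) (fun z => (Q z)^-1)
    (- (Q z) ^- 2 * (2 * z 0 i)).
  by have := derive_sqnorm1V z (delta_mx 0 i); rewrite sumE.
(* Half the logarithmic derivative of 4 / Q^2. In dimension 2 the quadratic term of the curvature
   formula has coefficient 0, and the divergence of [a] is - 4 / Q^2. *)
pose a (i : 'I_2) (z : 'rV[R]_2) := - 2 * (z 0 i * (Q z)^-1) : R.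
have da i z : is_derive z (delta_mx 0 i) (a i)
    (- 2 * (- z 0 i * (Q z) ^- 2 * (2 * z 0 i) + (Q z)^-1)).
  apply: is_derive_eq.
    exact: (is_deriveZ (- 2) (is_deriveM (derive_coord z (delta_mx 0 i) i) (dQV i z))).
  by rewrite mxE !eqxx /GRing.scale/=; ring.
rewrite (@scalar_curvature_conformally_flat _ _ setT (fun z => 4 / (1 + sqnorm z) ^+ 2) a) //.
- rewrite subrr mul0r addr0 !big_ord_recl big_ord0 addr0.
  rewrite /partial !(@derive_val _ _ _ _ _ _ _ (da _ _)).
  have : Q x = 1 + (x 0 ord0 ^+ 2 + x 0 (lift ord0 ord0) ^+ 2).
    by rewrite /Q /sqnorm !big_ord_recl big_ord0 addr0.
  rewrite -/(Q x); move: (Q0 x); set q := Q x => q0 qE.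
  have {}qE : x 0 ord0 ^+ 2 = q - 1 - x 0 (lift ord0 ord0) ^+ 2 by rewrite qE; ring.
  transitivity ((q * 2 - 2 * (x 0 ord0 ^+ 2 + x 0 (lift ord0 ord0) ^+ 2))); first by field.
  by rewrite qE; ring.
- exact: openT.
- by move=> z _; rewrite mulf_neq0// invr_neq0// expf_neq0//; exact: Q0.
- move=> i z _; have := is_deriveZ 4 (is_deriveX 2 (dQV i z)).
  move=> /(@derive_val _ _ _ _ _ _ _).
  rewrite (_ : 4 \*: _ = fun z => 4 / (1 + sqnorm z) ^+ 2); last first.
    by apply/funext => t; rewrite /= fctE exprVn.
  by rewrite /partial => ->; rewrite /a /GRing.scale/= -/(Q z); field; exact: Q0.
Qed.

(** * The solution on the hyperbolic space *)

Section solution.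
Context {R : realType} {m : nat}.
Local Notation H := (@half_space R m).
Local Notation d := (m.-1.+1).
Implicit Types (x : 'rV[R]_d) (i : 'I_d).

(** This is |x + e|^2, expanded so that its lower bound 1 on the half-space is immediate;
    [pole_dist2E] gives it back as a sum of squares. *)
Definition pole_dist2 x : R := 1 + 2 * x 0 ord_max + sqnorm x.

(** The solution is the case a = c, b = - c. With both exponents free, the family contains the
    powers of the solution and all terms that occur in its derivatives. *)
Definition pole_power (a b : R) x : R := x 0 ord_max `^ a * pole_dist2 x `^ b.

Lemma pole_dist2_ge1 x : H x -> 1 <= pole_dist2 x.
Proof.
move=> Hx; rewrite /pole_dist2 -addrA lerDl addr_ge0 ?sqnorm_ge0// mulr_ge0//.
exact: ltW.
Qed.

Lemma pole_dist2_gt0 x : H x -> 0 < pole_dist2 x.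
Proof. by move/pole_dist2_ge1; apply: lt_le_trans. Qed.

Lemma pole_power_gt0 a b x : H x -> 0 < pole_power a b x.
Proof. by move=> Hx; rewrite mulr_gt0// powR_gt0// pole_dist2_gt0. Qed.

Lemma pole_dist2E x : pole_dist2 x = \sum_i (x 0 i + (i == ord_max)%:R) ^+ 2.
Proof.
transitivity (\sum_i (x 0 i ^+ 2 + (ord_max == i)%:R * (2 * x 0 i + 1))).
  rewrite big_split/= sum_delta -/(sqnorm x) /pole_dist2; ring.
by apply: eq_bigr => i _; rewrite eq_sym; case: eqP => _ /=; ring.
Qed.

Lemma is_derive_height x i :
  is_derive x (delta_mx 0 i) (fun x => x 0 ord_max) (i == ord_max)%:R.
Proof.
by have := derive_coord x (delta_mx 0 i) ord_max; rewrite mxE eqxx eq_sym.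
Qed.

Lemma is_derive_pole_dist2 x i : is_derive x (delta_mx 0 i) pole_dist2
  (2 * (x 0 i + (i == ord_max)%:R)).
Proof.
apply: is_derive_eq.
  exact: (is_deriveD (is_deriveD (is_derive_cst (1 : R) x (delta_mx 0 i))
    (is_deriveZ 2 (is_derive_height x i))) (derive_sqnorm x (delta_mx 0 i))).
rewrite (_ : \sum_j _ = x 0 i); last first.
  rewrite -[RHS](@sum_delta R d i (fun k => x 0 k)).
  by apply: eq_bigr => k _; rewrite mxE eqxx mulrC eq_sym.
by rewrite /GRing.scale/=; ring.
Qed.

Lemma differentiable_height x : differentiable (fun x => x 0 ord_max : R) x.
Proof. exact: differentiable_coord. Qed.

Lemma differentiable_pole_dist2 x : differentiable pole_dist2 x.
Proof.
rewrite (_ : pole_dist2 = cst 1 + (fun x => 2 *: (x 0 ord_max : R)) +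
    \sum_(i < d) (fun x => x 0 i * x 0 i : R)); last first.
  by apply/funext => z; rewrite !fctE fct_sumE.
apply: differentiableD; last first.
  by apply: differentiable_sum => i; apply: differentiableM; exact: differentiable_coord.
apply: differentiableD; first exact: differentiable_cst.
by apply: differentiableZ; exact: differentiable_coord.
Qed.

Lemma is_derive_pole_power a b x i : H x ->
  is_derive x (delta_mx 0 i) (pole_power a b)
   (a * (i == ord_max)%:R * pole_power (a - 1) b x +
    2 * b * (x 0 i + (i == ord_max)%:R) * pole_power a (b - 1) x).
Proof.
move=> Hx; have q0 := pole_dist2_gt0 Hx.
apply: is_derive_eq.
  exact: (is_deriveM
    (is_derive_powR_comp a Hx (differentiable_height x) (is_derive_height x i))
    (is_derive_powR_comp b q0 (differentiable_pole_dist2 x) (is_derive_pole_dist2 x i))).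
by rewrite /GRing.scale/= /pole_power; ring.
Qed.

Lemma pole_powerMl a b e x : H x ->
  x 0 ord_max `^ e * pole_power a b x = pole_power (e + a) b x.
Proof.
move=> Hx; rewrite /pole_power mulrA powRD// (gt_eqF (x := x 0 ord_max))//.
exact: implybT.
Qed.

Lemma pole_powerMr a b x : H x ->
  pole_power a b x * pole_dist2 x = pole_power a (b + 1) x.
Proof.
move=> Hx; have q0 := pole_dist2_gt0 Hx; rewrite /pole_power -mulrA powRD; last first.
  by rewrite (gt_eqF q0) implybT.
by rewrite powRr1// ltW.
Qed.

Lemma hyperbolic_volume_densityE x : H x ->
  volume_density (@hyperbolic_metric R m) x = x 0 ord_max `^ (- d%:R).
Proof.
move=> Hx; rewrite /volume_density det_scalar -exprVn -exprM mulnC exprM.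
rewrite sqrtr_sqr ger0_norm; last by rewrite exprn_ge0// invr_ge0 ltW.
by rewrite powR_invn ?exprVn// ltW.
Qed.

Lemma hyperbolic_gradientE f i x :
  gradient (@hyperbolic_metric R m) f i x = x 0 ord_max ^+ 2 * partial i f x.
Proof.
rewrite /gradient; under eq_bigr do rewrite metric_inv_scalar -mulrA.
by rewrite sum_delta invrK.
Qed.

Lemma hyperbolic_density_gradient_pole_power i c z : 2 * c = d%:R - 2 -> H z ->
  volume_density (@hyperbolic_metric R m) z *
    gradient (@hyperbolic_metric R m) (pole_power c (- c)) i z =
  c * (i == ord_max)%:R * pole_power (- c - 1) (- c) z -
  2 * c * (z 0 i + (i == ord_max)%:R) * pole_power (- c) (- c - 1) z.
Proof.
move=> cd Hz; rewrite hyperbolic_volume_densityE// hyperbolic_gradientE.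
rewrite /partial (@derive_val _ _ _ _ _ _ _ (is_derive_pole_power c (- c) i Hz)).
rewrite -powR_mulrn ?ltW// mulrA -powRD; last by rewrite (@gt_eqF _ _ (z 0 ord_max))// implybT.
(* The weight sqrt(det g) times the inverse metric is y^(2 - d) = y^(-2c), which turns the exponent
   c of y into - c. *)
rewrite (_ : - d%:R + 2%:R = - 2 * c); last by rewrite mulNr cd opprB addrC.
transitivity (c * (i == ord_max)%:R * (z 0 ord_max `^ (- 2 * c) * pole_power (c - 1) (- c) z) -
  2 * c * (z 0 i + (i == ord_max)%:R) * (z 0 ord_max `^ (- 2 * c) * pole_power c (- c - 1) z)).
  by ring.
rewrite !pole_powerMl//.
by congr (_ * pole_power _ _ _ - _ * pole_power _ _ _); ring.
Qed.

(** The two terms of the flux produce opposite multiples of y^(-c-1) |x + e|^(-2c-2), which is why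
    no such mixed term remains. *)
Lemma is_derive_hyperbolic_density_gradient i c x : 2 * c = d%:R - 2 -> H x ->
  is_derive x (delta_mx 0 i)
   (fun z => volume_density (@hyperbolic_metric R m) z *
    gradient (@hyperbolic_metric R m) (pole_power c (- c)) i z)
  (- c * (c + 1) * (i == ord_max)%:R * pole_power (- c - 2) (- c) x
   - 2 * c * pole_power (- c) (- c - 1) x +
   4 * c * (c + 1) * (x 0 i + (i == ord_max)%:R) ^+ 2 * pole_power (- c) (- c - 2) x).
Proof.
move=> cd Hx.
pose F1 z := c * (i == ord_max)%:R * pole_power (- c - 1) (- c) z.
pose F2 (z : 'rV[R]_d) := - 2 * c * ((z 0 i + (i == ord_max)%:R) * pole_power (- c) (- c - 1) z).
apply: (@near_eq_is_derive _ _ _ (F1 + F2)).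
  apply: (open_near (@open_half_space R m)) => // z Hz.
  rewrite hyperbolic_density_gradient_pole_power// fctE /F1 /F2.
  by ring.
apply: is_derive_eq.
  exact: (is_deriveD (is_deriveZ _ (is_derive_pole_power _ _ i Hx))
   (is_deriveZ _ (is_deriveM (is_deriveD (derive_coord x (delta_mx 0 i) i)
    (is_derive_cst ((i == ord_max)%:R : R) x (delta_mx 0 i)))
    (is_derive_pole_power _ _ i Hx)))).
rewrite mxE !eqxx /GRing.scale/= !fctE.
have e : - c - 1 - 1 = - c - 2 by ring.
by rewrite !e; case: eqP => _ /=; ring.
Qed.

(** Summed over [i], the squares (x_i + e_i)^2 give |x + e|^2, so the last two terms of the
    derivative share the power |x + e|^(-2c-2), with coefficient - 2 c d + 4 c (c + 1) = 0: this is
    the harmonicity of |x + e|^(2 - d). Only the term from the height survives, and y^d = y^(2c+2)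
    restores its exponent. *)
Lemma laplacian_hyperbolic_pole_power c x : 2 * c = d%:R - 2 -> H x ->
  laplacian (@hyperbolic_metric R m) (pole_power c (- c)) x =
  c * (c + 1) * pole_power c (- c) x.
Proof.
move=> cd Hx; rewrite /laplacian /divergence.
under eq_bigr do rewrite /partial
  (@derive_val _ _ _ _ _ _ _ (is_derive_hyperbolic_density_gradient _ cd Hx)).
rewrite hyperbolic_volume_densityE// -powRN opprK.
rewrite !big_split/= -!mulr_suml -mulr_sumr.
rewrite -(mulr_sumr _ _ (fun i => (x 0 i + (i == ord_max)%:R) ^+ 2)) -pole_dist2E.
rewrite (_ : \sum_i (i == ord_max)%:R = 1); last first.
  rewrite -[RHS](@sum_delta R d ord_max (fun=> 1)).
  by apply: eq_bigr => i _; rewrite mulr1 eq_sym.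
rewrite -(mulrA _ (pole_dist2 x)) (mulrC (pole_dist2 x)) pole_powerMr//.
rewrite sumr_const card_ord -(mulr_natl (- _)) (_ : - c - 2 + 1 = - c - 1); last by ring.
have -> : d%:R = 2 * c + 2 by rewrite cd; ring.
transitivity (c * (c + 1) * (x 0 ord_max `^ (2 * c + 2) * pole_power (- c - 2) (- c) x)).
  by ring.
by rewrite pole_powerMl//; congr (_ * pole_power _ _ _); ring.
Qed.

End solution.

(** * The equation on the product *)

Lemma elementary_sum {R : realType} n (U : set 'rV[R]_n) k (F : 'I_k -> 'rV[R]_n -> R) :
  (forall i, elementary U (F i)) -> elementary U (fun x => \sum_i F i x).
Proof.
move=> eF; rewrite (_ : (fun x => _) = \sum_i F i); last first.
  by apply/funext => x; rewrite fct_sumE.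
by elim/big_ind : _ => // [|f g]; [exact: elementary_cst|exact: elementaryD].
Qed.

Section conformal.
Context {R : realType} {m : nat}.
Local Notation d := (m.-1.+1).
Local Notation U := (@hyp_sphere_dom R m).

Lemma open_hyp_sphere_dom : open U.
Proof.
rewrite (_ : U = lsubmx @^-1` half_space)//; apply: open_comp.
  by move=> x _; exact: differentiable_continuous (differentiable_lsubmx _).
exact: open_half_space.
Qed.

Lemma hyp_sphere_smooth_pole_power (a b : R) :
  @hyp_sphere_smooth R m (pole_power a b \o fst).
Proof.
move=> s; apply: elementary_smooth open_hyp_sphere_dom _.
rewrite (_ : _ \o _ = fun x : 'rV[R]_(d + 2) => x 0 (lshift 2 ord_max) `^ a *
  (1 + 2 * x 0 (lshift 2 ord_max) + \sum_i x 0 (lshift 2 i) * x 0 (lshift 2 i)) `^ b);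
  last first.
  apply/funext => x; rewrite /= /pole_power /pole_dist2 !mxE; congr (_ * (_ + _) `^ _).
  by apply: eq_bigr => i _; rewrite mxE.
apply: elementaryM; apply: elementary_powR.
- exact: elementary_coord.
- by move=> x Ux; have : 0 < lsubmx x 0 ord_max := Ux; rewrite mxE.
- apply: elementaryD; last first.
    by apply: elementary_sum => i; apply: elementaryM; exact: elementary_coord.
  apply: elementaryD; first exact: elementary_cst.
  by apply: elementaryM; [exact: elementary_cst|exact: elementary_coord].
- move=> x Ux; have := pole_dist2_gt0 Ux; rewrite /pole_dist2 mxE.
  by congr (_ < _ + _); apply: eq_bigr => i _; rewrite mxE.
Qed.

Lemma hyp_sphere_conformal_laplacian_pole_power b c x : 2 * c = d%:R - 2 -> U x ->
  @hyp_sphere_conformal_laplacian R m b (pole_power c (- c) \o fst) x = 0.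
Proof.
move=> cd Ux; rewrite /hyp_sphere_conformal_laplacian /conformal_laplacian.
have gU z : U z -> hyperbolic_metric (lsubmx z) \in unitmx.
  by move=> Uz; rewrite unitmxE det_scalar unitrX// unitfE invr_neq0// expf_neq0// gt_eqF.
have h_gt0 z : U z -> 0 < \det (induced_metric (@stereo R 2 b) (rsubmx z)).
  move=> _; rewrite induced_stereoE det_scalar exprn_gt0// divr_gt0// exprn_gt0//.
  by rewrite ltr_pwDl// sqnorm_ge0.
have hU z : U z -> induced_metric (@stereo R 2 b) (rsubmx z) \in unitmx.
  by move=> Uz; rewrite unitmxE unitfE gt_eqF// h_gt0.
rewrite (scalar_curvature_product open_hyp_sphere_dom gU hU Ux).
rewrite scalar_curvature_hyperbolic// scalar_curvature_sphere.
rewrite (_ : _ \o _ = pole_power c (- c) \o lsubmx)//.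
rewrite (laplacian_product open_hyp_sphere_dom gU hU _ h_gt0 Ux); last 2 first.
- by move=> z Uz; rewrite det_scalar exprn_ge0// invr_ge0 sqr_ge0.
- by move=> i; have [] := is_derive_hyperbolic_density_gradient i cd Ux.
rewrite laplacian_hyperbolic_pole_power//= natrD.
(* With n = d + 2 the denominator of a_n is d = 2c + 2; in terms of c the claim is a rational
   identity. *)
have d0 : d%:R + 2%:R - 2 != 0 :> R by rewrite addrK pnatr_eq0.
move: d0; have -> : d%:R = 2 * c + 2 by rewrite cd; ring.
move=> d0; field.
by move: d0; congr (_ != _); ring.
Qed.

End conformal.

(** * Integrals *)

Section integral_derivative.
Context {R : realType}.
Local Notation mu := (@lebesgue_measure R).

(** The fundamental theorem of calculus on compact intervals exhausting [D], then monotone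
    convergence. Only finiteness is needed later, so a bound on the increments of the primitive
    replaces its limits at the ends. *)
Lemma integral_derivative_le (a b : nat -> R) (D : set R) (f F : R -> R) C :
  D = \bigcup_k `[a k, b k]%classic ->
  {homo a : i j / (i <= j)%N >-> j <= i} -> {homo b : i j / (i <= j)%N >-> i <= j} ->
  (forall k, a k < b k) ->
  (forall x, D x -> 0 <= f x) ->
  (forall x, D x -> {for x, continuous f}) ->
  (forall x, D x -> is_derive x 1 F (f x)) ->
  (forall x z, D x -> D z -> F z - F x <= C) ->
  (\int[mu]_(x in D) (f x)%:E <= C%:E)%E.
Proof.
move=> DE amono bmono ab f0 cf dF FC.
have subD k : `[a k, b k]%classic `<=` D by move=> x xab; rewrite DE; exists k.
have cwf k : {within `[a k, b k], continuous f}.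
  apply: continuous_in_subspaceT => x /set_mem xab; apply: cf; exact: subD xab.
have intE k : (\int[mu]_(x in `[a k, b k]) (f x)%:E = (F (b k) - F (a k))%:E)%E.
  have Da : D (a k) by apply: (subD k); rewrite /= in_itv/= lexx ltW.
  have Db : D (b k) by apply: (subD k); rewrite /= in_itv/= lexx andbT ltW.
  have cF x : D x -> {for x, continuous F}.
    by move=> Dx; have [dFx _] := dF _ Dx; exact/differentiable_continuous/derivable1_diffP.
  rewrite (@continuous_FTC2 _ f F) ?EFinB//.
  - split.
    + move=> x xab; have Dx : D x by apply: (subD k); exact: subset_itv_oo_cc xab.
      by have [] := dF _ Dx.
    + by apply: cvg_at_right_filter; exact: cF.
    + by apply: cvg_at_left_filter; exact: cF.
  - move=> x xab; have Dx : D x by apply: (subD k); exact: subset_itv_oo_cc xab.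
    by rewrite derive1E; have [] := dF _ Dx.
have h : (\int[mu]_(x in `[a k, b k]) (f x)%:E @[k --> \oo] -->
    \int[mu]_(x in \bigcup_k `[a k, b k]%classic) (f x)%:E)%E.
  apply: ge0_nondecreasing_set_cvg_integral => //.
  - move=> i j ij; apply/subsetPset => x /=; rewrite !in_itv/= => /andP[ax xb].
    by rewrite (le_trans (amono _ _ ij) ax) (le_trans xb (bmono _ _ ij)).
  - by move=> k; apply/measurable_EFinP; exact: subspace_continuous_measurable_fun.
  - by move=> k x xab; rewrite lee_fin; apply/f0/(subD k).
rewrite DE -(cvg_lim _ h)//; apply: lime_le; first by apply/cvg_ex; eexists; exact: h.
apply: nearW => k; rewrite intE lee_fin; apply: FC; apply: (subD k).
  by rewrite /= in_itv/= lexx ltW.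
by rewrite /= in_itv/= lexx andbT ltW.
Qed.

Lemma integral_oneDsqrV_le : (\int[mu]_x ((1 + x ^+ 2)^-1)%:E <= pi%:E)%E.
Proof.
apply: (@integral_derivative_le (fun k => - k.+1%:R) (fun k => k.+1%:R) _ _ atan).
- apply/esym/seteqP; split => // x _;
  exists (Num.truncn `|x|) => //=; rewrite in_itv/= -ler_norml ltW//.
  exact: truncnS_gt.
- by move=> i j ij; rewrite lerN2 ler_nat.
- by move=> i j ij; rewrite ler_nat.
- by move=> k; rewrite gtrN.
- by move=> x _; rewrite invr_ge0 addr_ge0// sqr_ge0.
- by move=> x _; exact: continuous_oneDsqrV.
- move=> x z _ _; have := atan_gtNpi2 x; have := atan_ltpi2 z; lra.
Qed.

Lemma integral_powR_oneDpowR_le (t : R) : 0 < t ->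
  (\int[mu]_(x in `]0%R, +oo[) (t * x `^ (t - 1) * (1 + x `^ t) ^- 2)%:E <= 1%:E)%E.
Proof.
move=> t0.
have q0 x : 1 + x `^ t != 0 by rewrite gt_eqF// ltr_pwDl// powR_ge0.
have dq (x : R) : 0 < x -> is_derive x 1 (fun x => 1 + x `^ t) (t * x `^ (t - 1)).
  move=> x0; apply: is_derive_eq.
    exact: (is_deriveD (is_derive_cst (1 : R) x 1) (is_derive1_powR t x0)).
  by rewrite add0r.
have cpow (s x : R) : 0 < x -> {for x, continuous (@powR R ^~ s)}.
  move=> x0; have [d _] := is_derive1_powR s x0.
  exact/differentiable_continuous/derivable1_diffP.
(* The right end is k + 2 and not k + 1, so that the first interval is already nondegenerate. *)
apply: (@integral_derivative_le (fun k => k.+1%:R^-1) (fun k => k.+2%:R) _ _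
  (fun x => - (1 + x `^ t)^-1)).
- apply/seteqP; split => x /=; rewrite in_itv/= ?andbT.
    move=> x0; exists (maxn (Num.truncn x) (Num.truncn x^-1)) => //=.
    rewrite in_itv/=; apply/andP; split.
      rewrite invf_ple ?posrE//; apply: le_trans (ltW (truncnS_gt _)) _.
      by rewrite ler_nat ltnS leq_maxr.
    apply: le_trans (ltW (truncnS_gt _)) _.
    by rewrite ler_nat ltnS leqW// leq_maxl.
  by move=> [k _] /=; rewrite in_itv/= => /andP[+ _]; exact: lt_le_trans.
- by move=> i j ij; rewrite lef_pV2 ?posrE// ler_nat.
- by move=> i j ij; rewrite ler_nat.
- move=> k; apply: (@le_lt_trans _ _ 1); last by rewrite ltr1n.
  by rewrite invf_le1// ler1n.
- move=> x; rewrite /= in_itv/= andbT => x0.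
  by rewrite !mulr_ge0 ?powR_ge0 ?invr_ge0 ?sqr_ge0// ltW.
- move=> x; rewrite /= in_itv/= andbT => x0.
  apply: cvgM; first by apply: cvgM; [exact: cvg_cst|exact: cpow].
  apply: cvgV; first by rewrite expf_neq0.
  apply: cvgM; (apply: cvgD; [exact: cvg_cst|exact: cpow]).
- move=> x; rewrite /= in_itv/= andbT => x0; apply: is_derive_eq.
    have h := @is_deriveV _ _ x _ 1 (q0 x) (dq x x0).
    exact: (is_deriveN h).
  by rewrite /GRing.scale/=; ring.
- move=> x z; rewrite /= !in_itv/= !andbT => x0 z0.
  have h1 : 0 <= (1 + z `^ t)^-1 by rewrite invr_ge0 addr_ge0// powR_ge0.
  have h2 : (1 + x `^ t)^-1 <= 1 by rewrite invf_le1 ?ltr_pwDl ?powR_ge0// lerDl powR_ge0.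
  by lra.
Qed.

End integral_derivative.

(** * Integration over R^n and in a chart *)

Section lebesgue_rV_integral.
Context {R : realType}.
Local Notation mu := (@lebesgue_measure R).

Lemma measurable_prod_coord n (f : 'I_n -> R -> R) :
  (forall i, measurable_fun setT (f i)) ->
  measurable_fun setT (fun x : 'rV[R]_n => \prod_i f i (x 0 i)).
Proof.
move=> mf; apply: measurable_prod => i _.
exact: measurableT_comp (mf i) (measurable_coord_rV i).
Qed.

(** Tonelli, by induction on the dimension: the measure is a Dirac mass in dimension 0 and the image
    of a product measure under [cons_rV] afterwards. *)
Lemma integral_lebesgue_rV_prod n (f : 'I_n -> R -> R) :
  (forall i, measurable_fun setT (f i)) -> (forall i t, 0 <= f i t) ->
  (\int[lebesgue_rV n]_x (\prod_i f i (x 0 i))%:E =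
   \prod_(i < n) \int[mu]_t (f i t)%:E)%E.
Proof.
elim: n f => [|n IH] f mf f0.
  rewrite big_ord0 integral_dirac//; last first.
    by apply/measurable_EFinP; exact: measurable_prod_coord.
  by rewrite diracT mul1e big_ord0.
transitivity (\int[pushforward (mu \x lebesgue_rV n) (@cons_rV R n)]_x
   (\prod_i f i (x 0 i))%:E)%E => //.
rewrite ge0_integral_pushforward//; last 3 first.
- exact: measurable_cons_rV.
- by apply/measurable_EFinP; exact: measurable_prod_coord.
- by move=> x _; rewrite lee_fin; exact: prodr_ge0.
rewrite preimage_setT fubini_tonelli1//; last 2 first.
- apply: measurableT_comp; last exact: measurable_cons_rV.
  by apply/measurable_EFinP; exact: measurable_prod_coord.
- by move=> x /=; rewrite lee_fin; exact: prodr_ge0.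
have mP : measurable_fun setT (fun x : 'rV[R]_n => \prod_i f (lift ord0 i) (x 0 i)).
  exact: (@measurable_prod_coord n (fun i => f (lift ord0 i))).
rewrite big_ord_recl -(IH (fun i => f (lift ord0 i)))//.
rewrite -ge0_integralZr//; last 3 first.
- by apply/measurable_EFinP; exact: mf.
- by move=> t _; rewrite lee_fin.
- by apply: integral_ge0 => x _; rewrite lee_fin prodr_ge0.
apply: eq_integral => t _; rewrite /fubini_F -ge0_integralZl//; last 3 first.
- exact/measurable_EFinP.
- by move=> x _; rewrite lee_fin prodr_ge0.
- by rewrite lee_fin.
apply: eq_integral => x _; rewrite /= -EFinM big_ord_recl; congr (_ * _)%:E.
  by rewrite /cons_rV mxE; case: splitP => // j _; rewrite mxE ord1 eqxx mulr1n.
apply: eq_bigr => i _; rewrite /cons_rV (_ : lift ord0 i = rshift 1 i); last exact: val_inj.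
by congr (f _ _); apply: etrans (row_mxEr _ _ _ _) _.
Qed.

Lemma measurable_rV_box n (a b : 'I_n -> R) :
  measurable [set x : 'rV[R]_n | forall i, a i <= x 0 i <= b i].
Proof.
rewrite (_ : mkset _ = \bigcap_(i in [set: 'I_n])
    (fun x : 'rV[R]_n => x 0 i) @^-1` `[a i, b i]%classic).
  apply: fin_bigcap_measurable => // i _; rewrite -[X in measurable X]setTI.
  exact: (measurable_coord_rV i).
apply/seteqP; split => x /=.
  by move=> h i _ /=; rewrite in_itv/=.
by move=> h i; have := h i Logic.I; rewrite /= in_itv.
Qed.

Lemma lebesgue_rV_box n (a b : 'I_n -> R) : (forall i, a i <= b i) ->
  lebesgue_rV n [set x : 'rV[R]_n | forall i, a i <= x 0 i <= b i] =
  (\prod_i (b i - a i))%:E.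
Proof.
move=> ab.
transitivity (\int[lebesgue_rV n]_x (\prod_i \1_(`[a i, b i]%classic) (x 0 i : R))%:E)%E.
  rewrite -[LHS]mul1e -[in LHS]/(1%:E).
  set B := [set x | _].
  have mB : measurable B by exact: measurable_rV_box.
  rewrite -integral_cst//= integral_mkcond; apply: eq_integral => x _.
  rewrite patchE; case: ifPn => [/set_mem Bx|/negP Bx].
    by rewrite big1// => i _; rewrite indicE mem_set//= in_itv/=; exact: Bx.
  have /existsNP[i nBi] : ~ forall i, a i <= x 0 i <= b i by move=> h; apply/Bx/mem_set.
  by rewrite (bigD1 i)//= indicE memNset ?mul0r//= in_itv.
rewrite (integral_lebesgue_rV_prod (f := fun i t => \1_(`[a i, b i]%classic) t))//; last first.
  by move=> i; exact: measurable_indic.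
rewrite -prodEFin; apply: eq_bigr => i _.
rewrite integral_indic// setIT/= lebesgue_measure_itv/= lte_fin.
have := ab i; rewrite le_eqVlt => /predU1P[->|->]; last by rewrite EFinB.
by rewrite ltxx subrr.
Qed.

Import HBNNSimple.

(** Half of the change of variables formula, enough for finiteness. For a simple function it follows
    from the definition of the chart volume by linearity; the left side is a supremum over the
    simple functions below [f]. *)
Lemma integral_hyp_sphere_chart_volume_le m b
  (f : ('rV[R]_m.-1.+1 * 'rV[R]_(2 + 1))%type -> R) :
  measurable_fun setT f -> (forall p, 0 <= f p) ->
  (\int[@hyp_sphere_chart_volume R m b]_p (f p)%:E <=
   \int[lebesgue_rV (m.-1.+1 + 2)]_(x in @hyp_sphere_dom R m)
     (f (hyp_sphere_chart b x) * volume_density (hyp_sphere_metric b) x)%:E)%E.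
Proof.
move=> mf f0; set U := @hyp_sphere_dom R m.
set psi := @hyp_sphere_chart R m b; set D := volume_density _.
have mU : measurable U by exact: measurable_hyp_sphere_dom.
have mD : measurable_fun U D.
  by apply: measurable_funTS; exact: measurable_hyp_sphere_volume_density.
have mpsi : measurable_fun setT psi by exact: measurable_hyp_sphere_chart.
have mfpsi : measurable_fun U (f \o psi).
  by apply: measurable_funTS; exact: measurableT_comp.
have VE A : hyp_sphere_chart_volume b A =
    (\int[lebesgue_rV (m.-1.+1 + 2)]_(x in U) ((\1_A (psi x))%:E * (D x)%:E))%E.
  rewrite -[LHS]/(\int[lebesgue_rV (m.-1.+1 + 2)]_(x in U `&` psi @^-1` A) (D x)%:E)%E.
  rewrite integral_mkcondr; apply: eq_integral => x _.
  rewrite patchE indicE [in RHS](_ : (psi x \in A) = (x \in psi @^-1` A)) ?mem_preimage//.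
  by case: ifPn => _; rewrite ?mul1e ?mul0e.
have mindic (r : R) (h : {nnsfun ('rV[R]_m.-1.+1 * 'rV[R]_(2 + 1))%type >-> R}) :
    measurable_fun U (fun x => (\1_(h @^-1` [set r]) (psi x))%:E).
  apply/measurable_EFinP; apply: measurable_funTS.
  by apply: (measurableT_comp (measurable_indic _)).
rewrite ge0_integralTE; last by move=> p; rewrite lee_fin.
apply: ge_ereal_sup => _ [h /= hf <-].
have h0 t : 0 <= h t by exact: fun_ge0.
have mh : measurable_fun U (h \o psi) by apply: measurable_funTS; exact: measurableT_comp.
apply: (@le_trans _ _
  (\int[lebesgue_rV (m.-1.+1 + 2)]_(x in U) (h (psi x) * D x)%:E)%E); last first.
  apply: ge0_le_integral => //.
  - by move=> x _; rewrite lee_fin mulr_ge0// sqrtr_ge0.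
  - by apply/measurable_EFinP; exact: measurable_funM.
  - by apply/measurable_EFinP; exact: measurable_funM.
  - by move=> x _; rewrite lee_fin ler_wpM2r// ?sqrtr_ge0// -lee_fin.
have -> : (\int[lebesgue_rV (m.-1.+1 + 2)]_(x in U) (h (psi x) * D x)%:E =
    \int[lebesgue_rV (m.-1.+1 + 2)]_(x in U) \sum_(r \in range h)
      (r%:E * (\1_(h @^-1` [set r]) (psi x))%:E * (D x)%:E))%E.
  apply: eq_integral => x _.
  rewrite -ge0_mule_fsuml; last by move=> r; exact: nnfun_muleindic_ge0.
  rewrite [X in (X * _)%:E](fimfunE h) EFinM -fsumEFin//.
rewrite ge0_integral_fsum//.
- rewrite sintegralE; apply: lee_fsum => // r [t _ <-].
  under [leRHS]eq_integral do rewrite -muleA.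
  rewrite ge0_integralZl//.
  + by rewrite -VE; exact: lexx.
  + apply: emeasurable_funM; last exact/measurable_EFinP.
    exact: mindic.
  + by move=> x _; rewrite mule_ge0 ?lee_fin// sqrtr_ge0.
  + by rewrite lee_fin.
- move=> r; apply: emeasurable_funM; last exact/measurable_EFinP.
  by apply/measurable_EFinP; apply: measurable_funM => //; apply/measurable_EFinP; exact: mindic.
- move=> r x _; rewrite mule_ge0// ?lee_fin ?sqrtr_ge0//; exact: nnfun_muleindic_ge0.
Qed.

End lebesgue_rV_integral.

(** * Integrability of the solution *)

Section hyp_sphere_integrals.
Context {R : realType} {m : nat}.
Local Notation d := (m.-1.+1).
Local Notation M := (@hyp_sphere R m).
Local Notation U := (@hyp_sphere_dom R m).
Local Notation vol := (@hyp_sphere_volume R m).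
Local Notation mu := (@lebesgue_measure R).
Local Notation point := ('rV[R]_d * 'rV[R]_(2 + 1))%type.

Lemma measurable_pole_power (a b : R) :
  measurable_fun setT (@pole_power R m a b).
Proof.
have my : measurable_fun setT (fun x : 'rV[R]_d => x 0 ord_max : R).
  exact: measurable_coord_rV.
apply: measurable_funM; first exact: measurableT_comp (measurable_powR _) my.
apply: measurableT_comp (measurable_powR _) _.
apply: measurable_funD; last exact: measurable_sqnorm.
by apply: measurable_funD => //; exact: measurable_funM.
Qed.

Lemma measurable_hyp_sphere : measurable M.
Proof.
apply: measurableX; first exact: measurable_half_space.
rewrite (_ : sphere = @sqnorm R (2 + 1) @^-1` [set 1])//.
by rewrite -[X in measurable X]setTI; apply: measurable_sqnorm.
Qed.

Lemma hyp_sphere_chart_in b x : U x -> M (hyp_sphere_chart b x).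
Proof.
move=> Ux; split => //=.
have : range (@stereo R 2 b) (stereo b (rsubmx x)) by exists (rsubmx x).
by rewrite range_stereo => -[].
Qed.

Lemma hyp_sphere_densityE b x : U x ->
  volume_density (hyp_sphere_metric b) x =
  lsubmx x 0 ord_max ^- d * (4 / (1 + sqnorm (rsubmx x)) ^+ 2).
Proof.
move=> Ux; have y0 : 0 <= lsubmx x 0 ord_max by exact: ltW.
have s0 : 0 <= 4 / (1 + sqnorm (rsubmx x)) ^+ 2 by rewrite divr_ge0// sqr_ge0.
rewrite hyp_sphere_volume_densityE -exprVn -exprM mulnC exprM -exprMn.
by rewrite sqrtr_sqr ger0_norm ?exprVn// mulr_ge0// invr_ge0 exprn_ge0.
Qed.

(** In each chart the majorant is integrated by Tonelli; restricting the second chart to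
    [north_fiber] only decreases its measure. *)
Lemma integral_hyp_sphere_volume_lty (f : point -> R) (F : 'I_(d + 2) -> R -> R) :
  measurable_fun setT f -> (forall p, 0 <= f p) ->
  (forall i, measurable_fun setT (F i)) -> (forall i t, 0 <= F i t) ->
  (forall i, \int[mu]_t (F i t)%:E < +oo)%E ->
  (forall b x, U x -> f (hyp_sphere_chart b x) *
    volume_density (hyp_sphere_metric b) x <= \prod_i F i (x 0 i)) ->
  (\int[vol]_p (f p)%:E < +oo)%E.
Proof.
move=> mf f0 mF F0 Foo fF.
have chartoo b : (\int[hyp_sphere_chart_volume b]_p (f p)%:E < +oo)%E.
  apply: le_lt_trans (integral_hyp_sphere_chart_volume_le b mf f0) _.
  apply: (@le_lt_trans _ _ (\int[lebesgue_rV (d + 2)]_(x in U) (\prod_i F i (x 0 i))%:E)%E).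
    apply: ge0_le_integral.
    - exact: measurable_hyp_sphere_dom.
    - by move=> x _; rewrite lee_fin mulr_ge0// sqrtr_ge0.
    - apply/measurable_EFinP; apply: measurable_funTS; apply: measurable_funM.
        by apply: measurableT_comp => //; exact: measurable_hyp_sphere_chart.
      exact: measurable_hyp_sphere_volume_density.
    - by apply/measurable_EFinP; apply: measurable_funTS; exact: measurable_prod_coord.
    - by move=> x Ux; rewrite lee_fin; exact: fF.
  apply: (@le_lt_trans _ _ (\int[lebesgue_rV (d + 2)]_x (\prod_i F i (x 0 i))%:E)%E).
    apply: ge0_subset_integral => //.
    - exact: measurable_hyp_sphere_dom.
    - by apply/measurable_EFinP; exact: measurable_prod_coord.
    - by move=> x _; rewrite lee_fin prodr_ge0.
  rewrite integral_lebesgue_rV_prod// -ge0_fin_numE; last first.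
    by apply: prode_ge0 => i _; apply: integral_ge0 => t _; rewrite lee_fin.
  apply: prode_fin_num => i _; rewrite ge0_fin_numE//.
  by apply: integral_ge0 => t _; rewrite lee_fin.
rewrite ge0_integral_measure_add//; last 2 first.
- by move=> p _; rewrite lee_fin.
- exact/measurable_EFinP.
apply: lte_add_pinfty; first exact: chartoo.
apply: le_lt_trans (chartoo true).
apply: ge0_le_measure_integral => //.
- move=> S mS; apply: le_measure; rewrite ?inE//.
  by apply: measurableI => //; exact: measurable_north_fiber.
- exact/measurable_EFinP.
Qed.

Lemma pole_power_le1 c (x : 'rV[R]_d) : 0 <= c -> half_space x ->
  pole_power c (- c) x <= 1.
Proof.
move=> c0 Hx; have q0 := pole_dist2_gt0 Hx.
have yq : x 0 ord_max <= pole_dist2 x.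
  have : 0 < x 0 ord_max := Hx; have := sqnorm_ge0 x.
  by rewrite /pole_dist2; set y := x 0 ord_max; lra.
rewrite /pole_power powRN ler_pdivrMr ?powR_gt0// mul1r.
by apply: ge0_ler_powR => //; rewrite nnegrE ltW.
Qed.

Lemma measurable_hyp_sphere_restrict (a b : R) :
  measurable_fun setT ((pole_power a b \o fst) \_ M : point -> R).
Proof.
apply/(measurable_restrictT _ measurable_hyp_sphere).
apply: measurable_funTS; apply: measurableT_comp => //.
exact: measurable_pole_power.
Qed.

Lemma pole_power_ge0 (a b : R) (x : 'rV[R]_d) : 0 <= pole_power a b x.
Proof. by rewrite mulr_ge0// powR_ge0. Qed.

Lemma hyp_sphere_restrict_ge0 (a b : R) (p : point) :
  0 <= ((pole_power a b \o fst) \_ M) p.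
Proof. by rewrite patchE; case: ifP => // _; exact: pole_power_ge0. Qed.

Lemma Lfun_oo_pole_power (c : R) : 0 <= c ->
  (pole_power c (- c) \o fst) \_ M \in Lfun vol +oo.
Proof.
move=> c0; apply/andP; split; first by rewrite inE; exact: measurable_hyp_sphere_restrict.
rewrite inE/= /finite_norm unlock /Lnorm; case: ifPn => // _.
apply: (@le_lt_trans _ _ 1%:E); last exact: ltry.
apply/ess_supP; apply/nearW => p /=.
rewrite lee_fin ger0_norm ?hyp_sphere_restrict_ge0//.
by rewrite patchE; case: ifPn => // /set_mem[Hp _]; exact: pole_power_le1.
Qed.

End hyp_sphere_integrals.

Lemma mem_Lfun d (T : measurableType d) (R : realType) (mu : {measure set T -> \bar R})
    (f : T -> R) (r : R) : r != 0 -> measurable_fun setT f -> (forall x, 0 <= f x) ->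
  (f \in Lfun mu r%:E) = (\int[mu]_x (f x `^ r)%:E < +oo)%E.
Proof.
move=> r0 mf f0.
have E : (\int[mu]_x `|(f x)%:E| `^ r = \int[mu]_x (f x `^ r)%:E)%E.
  by apply: eq_integral => x _; rewrite /= ger0_norm// poweR_EFin.
apply/idP/idP => [/andP[_]|foo].
  rewrite inE/= /finite_norm unlock /Lnorm E; apply: lty_poweRy.
  by rewrite invr_neq0.
apply/andP; split; first by rewrite inE.
by rewrite inE/= /finite_norm unlock /Lnorm E; exact: poweR_lty.
Qed.

Section integrability.
Context {R : realType} {m : nat}.
Local Notation d := (m.-1.+1).
Local Notation M := (@hyp_sphere R m).
Local Notation U := (@hyp_sphere_dom R m).
Local Notation vol := (@hyp_sphere_volume R m).
Local Notation mu := (@lebesgue_measure R).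

Lemma pole_powerX (a b r : R) (x : 'rV[R]_d) :
  pole_power a b x `^ r = pole_power (a * r) (b * r) x.
Proof. by rewrite /pole_power powRM ?powR_ge0// -!powRrM. Qed.

(** With Q = |x + e|^(2t) and a = y^t, both Q >= 1 and Q >= a^2 hold, so (1 + a)^2 <= 2 + 2 a^2 <= 4
    Q. *)
Lemma pole_dist2_powR_le (t : R) (x : 'rV[R]_d) : 0 <= t -> half_space x ->
  pole_dist2 x `^ (- t) <= 4 * (1 + x 0 ord_max `^ t) ^- 2.
Proof.
move=> t0 Hx; have q1 := pole_dist2_ge1 Hx; have q0 := pole_dist2_gt0 Hx.
have y0 : 0 < x 0 ord_max := Hx.
have yq : x 0 ord_max ^+ 2 <= pole_dist2 x.
  rewrite pole_dist2E (bigD1 ord_max)//= eqxx /= -[leLHS]addr0 lerD//.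
    by rewrite sqrrD mulr1 expr1n -addrA lerDl addr_ge0// mulrn_wge0// ltW.
  by apply: sumr_ge0 => i _; exact: sqr_ge0.
have Q1 : 1 <= pole_dist2 x `^ t.
  have := @ge0_ler_powR R t t0 1 (pole_dist2 x).
  by rewrite powR1 !nnegrE; apply => //; exact: ltW.
have yQ : (x 0 ord_max `^ t) ^+ 2 <= pole_dist2 x `^ t.
  rewrite -powR_mulrn ?powR_ge0// -powRrM mulrC powRrM powR_mulrn; last exact: ltW.
  by apply: ge0_ler_powR => //; rewrite nnegrE ?sqr_ge0//; exact: ltW.
rewrite powRN; move: Q1 yQ (powR_ge0 (x 0 ord_max) t).
set Q := _ `^ t; set a := _ `^ t => Q1 aQ a0.
rewrite ler_pdivlMr ?exprn_gt0 ?ltr_pwDl// mulrC ler_pdivrMr ?(lt_le_trans ltr01)//.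
have : 0 <= (1 - a) ^+ 2 by exact: sqr_ge0.
rewrite !expr2 in aQ *; lra.
Qed.

(* Used with t = 1 - 4 / m, for which m - 1 + t = m - 4 / m is p_n times the  *)
(* exponent c of the solution.                                                *)
Lemma pole_power_density_le (t : R) (x : 'rV[R]_d) : 0 <= t -> half_space x ->
  pole_power (m.-1%:R + t) (- (m.-1%:R + t)) x * x 0 ord_max ^- d <=
  4 * (x 0 ord_max `^ (t - 1) * (1 + x 0 ord_max `^ t) ^- 2) *
  \prod_(j < d | j != ord_max) (1 + x 0 j ^+ 2)^-1.
Proof.
move=> t0 Hx; have q1 := pole_dist2_ge1 Hx; have q0 := pole_dist2_gt0 Hx.
have y0 : 0 < x 0 ord_max := Hx.
(* One factor |x + e|^(-2) is set aside for each of the m - 1 horizontal coordinates, to be bounded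
   by 1 / (1 + x_j^2); the remaining |x + e|^(-2t) controls the height. *)
have -> : pole_power (m.-1%:R + t) (- (m.-1%:R + t)) x * x 0 ord_max ^- d =
    x 0 ord_max `^ (t - 1) * pole_dist2 x `^ (- t) * (pole_dist2 x)^-1 ^+ m.-1.
  rewrite -(powR_invn _ (ltW y0)) mulrC pole_powerMl// /pole_power -mulrA; congr (_ `^ _ * _).
    by rewrite -natr1; ring.
  by rewrite exprVn -(powR_invn _ (ltW q0)) -powRD ?(gt_eqF q0) ?implybT// opprD addrC.
rewrite [4 * _]mulrCA; apply: ler_pM.
- by rewrite mulr_ge0// powR_ge0.
- by rewrite exprn_ge0// invr_ge0 ltW.
- by rewrite ler_wpM2l ?powR_ge0// pole_dist2_powR_le.
have -> : (pole_dist2 x)^-1 ^+ m.-1 = \prod_(j < d | j != ord_max) (pole_dist2 x)^-1.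
  by rewrite (eq_bigl (mem (predC1 (ord_max : 'I_d))))// prodr_const cardC1 card_ord.
apply: ler_prod => j jmax; rewrite invr_ge0 ltW//= lef_pV2 ?posrE// ?ltr_pwDl ?sqr_ge0//.
rewrite pole_dist2E (bigD1 ord_max)//= (bigD1 j)//= (negbTE jmax) addr0 eqxx /=.
rewrite lerD//; first by rewrite sqrrD mulr1 expr1n lerDr addr_ge0 ?sqr_ge0// mulrn_wge0// ltW.
by rewrite lerDl; apply: sumr_ge0 => i _; exact: sqr_ge0.
Qed.

(** For nonnegative a and b, (1 + a + b)^2 >= (1 + a) (1 + b). *)
Lemma sphere_density_le (z : 'rV[R]_2) :
  4 / (1 + sqnorm z) ^+ 2 <= \prod_i (2 * (1 + z 0 i ^+ 2)^-1).
Proof.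
rewrite !big_ord_recl big_ord0 mulr1 mulrACA -natrM -invfM.
rewrite ler_wpM2l// lef_pV2 ?posrE ?exprn_gt0 ?mulr_gt0 ?ltr_pwDl ?sqr_ge0 ?sqnorm_ge0//.
rewrite /sqnorm !big_ord_recl big_ord0 addr0.
set a := _ ^+ 2; set b := _ ^+ 2.
have a0 : 0 <= a by exact: sqr_ge0.
have b0 : 0 <= b by exact: sqr_ge0.
have : 0 <= a * b by exact: mulr_ge0.
by have := sqr_ge0 a; have := sqr_ge0 b; rewrite !expr2; lra.
Qed.

(** The indicator is there because the majorant is integrated over the whole line in each
    coordinate. *)
Let height_bound (t s : R) : R :=
  \1_(`]0, +oo[%classic) s * (4 * (s `^ (t - 1) * (1 + s `^ t) ^- 2)).

Let bound (t : R) (i : 'I_(d + 2)) (s : R) : R :=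
  match fintype.split i with
  | inl j => if j == ord_max then height_bound t s else (1 + s ^+ 2)^-1
  | inr _ => 2 * (1 + s ^+ 2)^-1
  end.

Let bound_lshift t j s : bound t (lshift 2 j) s =
  if j == ord_max then height_bound t s else (1 + s ^+ 2)^-1.
Proof. by rewrite /bound (unsplitK (inl _)). Qed.

Let bound_rshift t j s : bound t (rshift d j) s = 2 * (1 + s ^+ 2)^-1.
Proof. by rewrite /bound (unsplitK (inr _)). Qed.

Let measurable_oneDsqrV : measurable_fun setT (fun s : R => (1 + s ^+ 2)^-1).
Proof. exact: continuous_measurable_fun continuous_oneDsqrV. Qed.

Let oneDsqrV_ge0 (s : R) : 0 <= (1 + s ^+ 2)^-1.
Proof. by rewrite invr_ge0 addr_ge0// sqr_ge0. Qed.

Let measurable_bound t i : measurable_fun setT (bound t i).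
Proof.
rewrite /bound; case: fintype.split => j; last exact: measurable_funM.
case: (j == ord_max) => //=; apply: measurable_funM; first exact: measurable_indic.
apply: measurable_funM => //; apply: measurable_funM; first exact: measurable_powR.
apply: measurable_inv_ge0 => [s|]; first exact: sqr_ge0.
by apply: measurable_funX; apply: measurable_funD => //; exact: measurable_powR.
Qed.

Let bound_ge0 t i s : 0 <= bound t i s.
Proof.
rewrite /bound; case: fintype.split => j; last by rewrite mulr_ge0.
by case: (j == ord_max) => //=; rewrite !mulr_ge0 ?powR_ge0// invr_ge0 sqr_ge0.
Qed.

Let integral_bound t i : 0 < t -> (\int[mu]_s (bound t i s)%:E < +oo)%E.
Proof.
move=> t0; rewrite /bound.
have fin : (\int[mu]_s ((1 + s ^+ 2)^-1)%:E < +oo)%E.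
  exact: le_lt_trans (@integral_oneDsqrV_le R) (ltry _).
case: fintype.split => j; last first.
  under eq_integral do rewrite EFinM.
  rewrite ge0_integralZl_EFin//; first by rewrite lte_mul_pinfty.
  - by move=> s _; rewrite lee_fin.
  - exact/measurable_EFinP.
case: (j == ord_max) => //=.
rewrite /height_bound.
have -> : (\int[mu]_s (\1_(`]0, +oo[%classic) s *
      (4 * (s `^ (t - 1) * (1 + s `^ t) ^- 2)))%:E =
    (4 / t)%:E * \int[mu]_(s in `]0%R, +oo[) (t * s `^ (t - 1) * (1 + s `^ t) ^- 2)%:E)%E.
  rewrite -ge0_integralZl_EFin//; last 3 first.
  - by move=> s _; rewrite lee_fin !mulr_ge0 ?powR_ge0 ?(ltW t0)// invr_ge0 sqr_ge0.
  - apply/measurable_EFinP; apply: measurable_funTS; apply: measurable_funM.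
      by apply: measurable_funM => //; exact: measurable_powR.
    apply: measurable_inv_ge0 => [s|]; first exact: sqr_ge0.
    by apply: measurable_funX; apply: measurable_funD => //; exact: measurable_powR.
  - by rewrite divr_ge0// ltW.
  rewrite [RHS]integral_mkcond; apply: eq_integral => s _.
  rewrite patchE indicE; case: ifP => _; last by rewrite mul0r.
  by rewrite mul1r -EFinM -!mulrA mulKf// gt_eqF.
rewrite lte_mul_pinfty ?lee_fin ?divr_ge0 ?ltW//.
exact: le_lt_trans (integral_powR_oneDpowR_le t0) (ltry _).
Qed.

Lemma Lfun_pole_power : (5 <= d)%N ->
  (pole_power ((d%:R - 2) / 2) (- ((d%:R - 2) / 2)) \o fst) \_ M
  \in Lfun vol (2 * (d%:R + 2) / d%:R)%:E.
Proof.
move=> d5; have d0 : 0 < d%:R :> R by rewrite ltr0n.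
set c := (d%:R - 2) / 2; set p := 2 * (d%:R + 2) / d%:R.
have p0 : 0 < p by rewrite divr_gt0// mulr_gt0// addr_gt0.
(* Its positivity is where d > 4 enters: it makes y^(t - 1) integrable at 0. *)
pose t : R := 1 - 4 / d%:R.
have t0 : 0 < t by rewrite subr_gt0 ltr_pdivrMr// mul1r ltr_nat.
have cp : c * p = m.-1%:R + t.
  have -> : m.-1%:R = d%:R - 1 :> R by rewrite -natr1 addrK.
  by rewrite /c /p /t; field; rewrite gt_eqF.
rewrite mem_Lfun//; [|by rewrite gt_eqF|exact: measurable_hyp_sphere_restrict|
  exact: hyp_sphere_restrict_ge0].
apply: (@integral_hyp_sphere_volume_lty _ _ _ (bound t)) => //.
- apply: (measurableT_comp (measurable_powR p)).
  exact: measurable_hyp_sphere_restrict.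
- by move=> q; exact: powR_ge0.
- by move=> i; exact: integral_bound.
move=> b x Ux.
rewrite patchE mem_set; last exact: hyp_sphere_chart_in.
rewrite hyp_sphere_densityE//= pole_powerX mulNr cp (mulrA (pole_power _ _ _)).
have h1 : 0 <= pole_power (m.-1%:R + t) (- (m.-1%:R + t)) (lsubmx x) *
    lsubmx x 0 ord_max ^- d.
  by rewrite mulr_ge0 ?pole_power_ge0// invr_ge0 exprn_ge0// ltW.
have h2 : 0 <= 4 / (1 + sqnorm (rsubmx x)) ^+ 2 by rewrite divr_ge0// sqr_ge0.
apply: le_trans (ler_pM h1 h2 (pole_power_density_le (ltW t0) Ux) (sphere_density_le _)) _.
rewrite big_split_ord/=; apply: ler_pM.
- rewrite !mulr_ge0 ?powR_ge0// ?invr_ge0 ?sqr_ge0//.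
  by apply: prodr_ge0 => j _.
- by apply: prodr_ge0 => j _; rewrite mulr_ge0.
- rewrite [leRHS](bigD1 ord_max)//= bound_lshift eqxx /height_bound indicE mem_set; last first.
    by rewrite /= in_itv/= andbT; have : 0 < lsubmx x 0 ord_max := Ux; rewrite mxE.
  rewrite mul1r !mxE; apply: ler_wpM2l.
    by rewrite !mulr_ge0 ?powR_ge0// ?invr_ge0 ?sqr_ge0//.
  apply: ler_prod => j /negbTE jmax; rewrite bound_lshift jmax mxE lexx andbT.
  exact: oneDsqrV_ge0.
- by apply: ler_prod => j _; rewrite bound_rshift mxE lexx andbT mulr_ge0.
Qed.

End integrability.

(** * Failure of square integrability *)

Lemma notin_Lfun2_pole_power {R : realType} {m : nat} : (2 <= m)%N ->
  (pole_power ((m.-1.+1%:R - 2) / 2) (- ((m.-1.+1%:R - 2) / 2)) \o fst) \_ (@hyp_sphere R m)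
  \notin Lfun (@hyp_sphere_volume R m) 2%:E.
Proof.
set d := m.-1.+1; set c : R := (d%:R - 2) / 2 => m2.
set M := @hyp_sphere R m; set U := @hyp_sphere_dom R m.
set w := (_ \o _) \_ M.
have mw : measurable_fun setT w by exact: measurable_hyp_sphere_restrict.
(* Since 2c = d - 2 = e, the square of the solution is the natural power (y / |x + e|^2)^e. *)
have [e de] : exists e, d = e.+2 by case: m m2 @d {c M U w mw} => [|[|e]]// _; exists e.
apply/negP; rewrite mem_Lfun//; last exact: hyp_sphere_restrict_ge0.
pose f p := w p `^ 2.
have f0 p : 0 <= f p by exact: powR_ge0.
have mf : measurable_fun setT f by exact: (measurableT_comp (measurable_powR 2) mw).
set I := (\int[_]_p _)%E => Ioo.
have I0 : (0 <= I)%E by apply: integral_ge0 => p _; rewrite lee_fin powR_ge0.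
have If : I \is a fin_num by rewrite ge0_fin_numE.
(* On the box all coordinates are in [0, 1], so |x + e|^2 <= 1 + 2 + d = K and the sphere density is
   at least 4 / (1 + 2)^2. The lower bound (eps / K)^e (2 eps)^(-d) (4 / 9) eps equals C / eps
   because d = e + 2. *)
pose K : R := 3 + d%:R.
have K0 : 0 < K by rewrite addr_gt0.
pose C : R := K ^- e * (2 ^- d * (4 / 9)).
have C0 : 0 < C by rewrite !mulr_gt0// ?invr_gt0 ?exprn_gt0// divr_gt0.
(* C / eps bounds from below the integral over the points with y in           *)
(* [eps, 2 eps] and all other chart coordinates in [0, 1].                    *)
suff lower (eps : R) : 0 < eps -> eps <= 2^-1 -> ((C / eps)%:E <= I)%E.
  have I0' : 0 <= fine I by exact: fine_ge0.
  (* Then C / eps = 2 (I + C + 1) exceeds I, and the summand C ensures eps <= 1/2, so that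
     [eps, 2 eps] lies in [0, 1]. *)
  pose eps : R := C / (2 * (fine I + C + 1)).
  have D0 : 0 < 2 * (fine I + C + 1) by lra.
  have eps0 : 0 < eps by rewrite divr_gt0.
  have eps2 : eps <= 2^-1.
    by rewrite ler_pdivrMr// mulrA mulVf// mul1r; lra.
  have := lower _ eps0 eps2; rewrite -(fineK If) lee_fin /eps invf_div mulrCA.
  by rewrite mulfV ?gt_eqF// mulr1; lra.
move=> eps0 eps2.
pose a (i : 'I_(d + 2)) : R := if i == lshift 2 ord_max then eps else 0.
pose b (i : 'I_(d + 2)) : R := if i == lshift 2 ord_max then 2 * eps else 1.
have ab i : a i <= b i by rewrite /a /b; case: ifP => // _; lra.
have a0 i : 0 <= a i by rewrite /a; case: ifP => // _; exact: ltW.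
have b1 i : b i <= 1 by rewrite /b; case: ifP => // _; lra.
pose box := [set x : 'rV[R]_(d + 2) | forall i, a i <= x 0 i <= b i].
have mbox : measurable box by exact: measurable_rV_box.
have vbox : lebesgue_rV (d + 2) box = eps%:E.
  rewrite lebesgue_rV_box// (bigD1 (lshift 2 ord_max))//= big1 => [|i /negbTE ni].
    by rewrite mulr1 /a /b eqxx; congr EFin; ring.
  by rewrite /a /b ni subr0.
pose B := [set x : 'rV[R]_d | forall j, a (lshift 2 j) <= x 0 j <= b (lshift 2 j)].
have BE x : B x -> [/\ eps <= x 0 ord_max, x 0 ord_max <= 2 * eps &
    forall j, 0 <= x 0 j <= 1].
  move=> Bx; split.
  - by have /andP[] := Bx ord_max; rewrite /a eqxx.
  - by have /andP[_] := Bx ord_max; rewrite /b eqxx.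
  - move=> j; have /andP[h1 h2] := Bx j.
    by rewrite (le_trans _ h1)// (le_trans h2).
(* The chart sends the box into this set, which constrains only the hyperbolic coordinates; the
   solution does not depend on the point of the sphere. *)
pose A := [set p : 'rV[R]_d * 'rV[R]_(2 + 1) | B p.1] `&` M.
have mA : measurable A.
  apply: measurableI; last exact: measurable_hyp_sphere.
  rewrite -[X in measurable X]setTI.
  by apply: measurable_fst => //; exact: measurable_rV_box.
have boxB x : box x -> B (lsubmx x) by move=> bx j; rewrite mxE; exact: bx.
have boxU x : box x -> U x.
  by move=> /boxB/BE[+ _ _]; exact: lt_le_trans.
have le_density x : box x -> (2 * eps) ^- d * (4 / 9) <=
    volume_density (hyp_sphere_metric false) x.
  move=> bx; have Ux := boxU _ bx; have [h1 h2 _] := BE _ (boxB _ bx).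
  rewrite hyp_sphere_densityE//; apply: ler_pM.
  - by rewrite invr_ge0 exprn_ge0// mulr_ge0// ltW.
  - by rewrite divr_ge0.
  - have y0 : 0 < lsubmx x 0 ord_max by exact: lt_le_trans h1.
    by rewrite lef_pV2 ?posrE ?exprn_gt0// ?mulr_gt0// lerXn2r// nnegrE ?ltW// mulr_gt0.
  - rewrite ler_wpM2l// lef_pV2 ?posrE// ?exprn_gt0 ?ltr_pwDl ?sqnorm_ge0//.
    have z1 (j : 'I_2) : rsubmx x 0 j ^+ 2 <= 1.
      rewrite mxE; have /andP[z0 zb] := bx (rshift d j).
      by rewrite expr_le1// ?(le_trans zb)// (le_trans _ z0).
    have s2 : sqnorm (rsubmx x) <= 2.
      rewrite /sqnorm !big_ord_recl big_ord0 addr0.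
      by have := z1 ord0; have := z1 (lift ord0 ord0); lra.
    rewrite (_ : 9 = 3 ^+ 2); last by ring.
    rewrite lerXn2r// ?nnegrE ?addr_ge0 ?sqnorm_ge0//; lra.
have volA : (((2 * eps) ^- d * (4 / 9) * eps)%:E <= @hyp_sphere_volume R m A)%E.
  rewrite [leRHS](measure_addE (hyp_sphere_chart_volume false)).
  (* For a lower bound the volume in the first chart is enough. *)
  apply: (@le_trans _ _ (hyp_sphere_chart_volume false A)); last exact: leeDl.
  rewrite /hyp_sphere_chart_volume /chart_volume EFinM -vbox -integral_cst//.
  have mUA : measurable (U `&` hyp_sphere_chart false @^-1` A).
    apply: measurableI; first exact: measurable_hyp_sphere_dom.
    rewrite -[X in measurable X]setTI.
    by apply: measurable_hyp_sphere_chart.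
  have mD : measurable_fun setT (EFin \o volume_density (hyp_sphere_metric (R:=R) (m:=m) false)).
    by apply/measurable_EFinP; exact: measurable_hyp_sphere_volume_density.
  apply: (@le_trans _ _ (\int[lebesgue_rV (d + 2)]_(x in box)
     (volume_density (hyp_sphere_metric false) x)%:E)%E).
    apply: ge0_le_integral => //.
    - by move=> x _; rewrite lee_fin !mulr_ge0// invr_ge0 exprn_ge0// mulr_ge0// ltW.
    - exact: measurable_funTS mD.
  apply: ge0_subset_integral => //.
  - exact: measurable_funTS mD.
  - by move=> x _; rewrite lee_fin sqrtr_ge0.
  - move=> x bx; have Ux := boxU _ bx; split => //.
    by split; [exact: boxB|exact: hyp_sphere_chart_in].
have le_f p : A p -> (eps / K) ^+ e <= f p.
  move=> [Bp Mp]; have [h1 h2 h3] := BE _ Bp; have Hp : half_space p.1 by case: Mp.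
  have y0 : 0 < p.1 0 ord_max := Hp; have q0 := pole_dist2_gt0 Hp.
  rewrite /f /w patchE mem_set//= pole_powerX.
  have c2 : c * 2 = e%:R by rewrite /c divfK// de -addn2 natrD addrK.
  rewrite mulNr c2.
  rewrite /pole_power powR_mulrn ?(ltW y0)// powR_invn ?(ltW q0)// -exprVn -exprMn.
  have qK : pole_dist2 p.1 <= K.
    rewrite /pole_dist2 /K.
    have : sqnorm p.1 <= d%:R.
      have -> : d%:R = \sum_(j < d) (1 : R) by rewrite sumr_const card_ord.
      by apply: ler_sum => j _; have /andP[z0 zb] := h3 j; rewrite expr_le1.
    by lra.
  apply: lerXn2r; rewrite ?nnegrE ?divr_ge0 ?(ltW eps0) ?(ltW y0) ?(ltW q0) ?(ltW K0)//.
  by apply: ler_pM; rewrite ?invr_ge0 ?(ltW eps0) ?(ltW K0)// lef_pV2.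
apply: (@le_trans _ _ (\int[@hyp_sphere_volume R m]_(p in A) (f p)%:E)%E); last first.
  by apply: ge0_subset_integral => //; [exact/measurable_EFinP|move=> p _; rewrite lee_fin].
apply: (@le_trans _ _ (\int[@hyp_sphere_volume R m]_(p in A) (cst (((eps / K) ^+ e)%:E) p))%E).
  rewrite integral_cst//.
  apply: le_trans (lee_wpmul2l _ volA); last by rewrite lee_fin exprn_ge0// divr_ge0// ltW.
  rewrite -EFinM lee_fin /C de !exprMn !exprS exprVn le_eqVlt; apply/orP; left; apply/eqP.
  by field; rewrite !gt_eqF ?exprn_gt0.
apply: ge0_le_integral => //.
- by move=> p _; rewrite lee_fin exprn_ge0// divr_ge0// ltW.
- by apply: measurable_funTS; exact/measurable_EFinP.
Qed.

Theorem proposition4p1 (R : realType) (n : nat) (hn : (7 <= n)%N) :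
  let M := @hyp_sphere R (n - 2) in
  let vol := @hyp_sphere_volume R (n - 2) in
  let p_n : R := 2 * n%:R / (n%:R - 2) in
  exists u : 'rV[R]_((n - 2).-1.+1) * 'rV[R]_(2 + 1) -> R,
    [/\ hyp_sphere_smooth u,
        forall p, M p -> 0 < u p,
        u \_ M \in Lfun vol +oo /\ u \_ M \in Lfun vol p_n%:E,
        forall b x, hyp_sphere_dom x -> hyp_sphere_conformal_laplacian b u x = 0
      & u \_ M \notin Lfun vol 2%:E].
Proof.
move=> M vol p_n; set d := (n - 2).-1.+1.
(* [d] is n - 2 because n - 2 is positive, so the successor of its predecessor changes nothing. *)
have nd : n = (d + 2)%N by rewrite /d prednK ?subn_gt0 ?subnK// (leq_trans _ hn).
have d5 : (5 <= d)%N by rewrite -(leq_add2r 2) -nd.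
pose c : R := (d%:R - 2) / 2.
have cd : 2 * c = d%:R - 2 by rewrite /c mulrCA mulfV ?mulr1.
have c0 : 0 <= c by rewrite divr_ge0// subr_ge0 ler_nat (leq_trans _ d5).
exists (pole_power c (- c) \o fst); split.
- exact: hyp_sphere_smooth_pole_power.
- by move=> p [Hp _]; exact: pole_power_gt0.
- split; first exact: Lfun_oo_pole_power.
  rewrite (_ : p_n = 2 * (d%:R + 2) / d%:R); first exact: Lfun_pole_power.
  by rewrite /p_n {1 2}nd natrD addrK.
- by move=> b x Ux; exact: hyp_sphere_conformal_laplacian_pole_power.
- by apply: notin_Lfun2_pole_power; rewrite (leq_trans _ (leq_sub2r 2 hn)).
Qed.
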